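(* If $b,c\ge 2$ are relatively prime integers, then the set $\mathcal{N}_b\setminus\mathcal{N}_c$ is $D_2(\boldsymbol{\Pi}^0_3)$-complete.
   Context: All sets are regarded as subsets of $\mathbb{R}$. For an integer $b\ge2$, $\mathcal{N}_b$ is the set of base-$b$ normal numbers $x\in[0,1)$: for every finite base-$b$ digit string $s$, the number of occurrences of $s$ among the first $n$ base-$b$ digits of $x$, divided by $n$, tends to $b^{-|s|}$. Borel classes: $\boldsymbol{\Sigma}^0_2$ is the class of countable unions of closed sets; $\boldsymbol{\Pi}^0_3$ is the class of countable intersections of $\boldsymbol{\Sigma}^0_2$ sets; $D_2(\boldsymbol{\Pi}^0_3)=\{A\setminus B: A,B\in\boldsymbol{\Pi}^0_3\}$. A set $A\subseteq\mathbb{R}$ is $\Gamma$-hard if for every zero-dimensional Polish space $X$ and every $B\subseteq X$ in class $\Gamma$ there is a continuous $f:X\to\mathbb{R}$ with $B=f^{-1}(A)$; it is $\Gamma$-complete if moreover $A\in\Gamma$. *)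

(* Defs.v *)
From HB Require Import structures.
From mathcomp Require Import all_boot all_order all_algebra.
From mathcomp Require Import all_classical all_reals all_analysis.
From mathcomp Require Import borel_hierarchy.

Set Implicit Arguments.
Unset Strict Implicit.
Unset Printing Implicit Defensive.

Import Order.TTheory GRing.Theory Num.Theory.
Import numFieldNormedType.Exports.

Local Open Scope classical_set_scope.
Local Open Scope ring_scope.

Definition is_metric (R : realType) (T : Type) (d : T -> T -> R) : Prop :=
  [/\ forall x, d x x = 0,
      forall x y, d x y = 0 -> x = y,
      forall x y, d x y = d y x &
      forall x y z, d x z <= d x y + d y z].

Definition induces_topology (R : realType) (T : topologicalType)
    (d : T -> T -> R) : Prop :=
  forall x : T, nbhs x = nbhs_ball_ (fun y e => [set z | d y z < e]) x.

Definition complete_metric (R : realType) (T : topologicalType)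
    (d : T -> T -> R) : Prop :=
  forall u : nat -> T,
    (forall e : R, 0 < e -> exists N : nat,
       forall m n : nat, (N <= m)%N -> (N <= n)%N -> d (u m) (u n) < e) ->
    exists l : T, u @ \oo --> l.

Definition polish_space (R : realType) (T : topologicalType) : Prop :=
  (exists2 D : set T, countable D & dense D) /\
  (exists d : T -> T -> R,
     [/\ is_metric d, induces_topology d & complete_metric d]).

(* The library's [zero_dimensional] only asks that clopen sets separate points,
   which is strictly weaker than having a clopen basis, even for Polish spaces
   (complete Erdos space). *)
Definition clopen_based (T : topologicalType) : Prop := basis (@clopen T).

Definition pointclass := forall T : topologicalType, set (set T).

(* The library's [Fsigma] is Sigma^0_2. *)
Definition Pi03 : pointclass := fun T S =>
  exists2 F : (set T)^nat, (forall i, Fsigma (F i)) & S = \bigcap_i F i.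

Definition D2 (Gamma : pointclass) : pointclass := fun T S =>
  exists A B : set T, [/\ Gamma T A, Gamma T B & S = A `\` B].

Definition hard (R : realType) (Gamma : pointclass) (A : set R) : Prop :=
  forall X : topologicalType, polish_space R X -> clopen_based X ->
  forall B : set X, Gamma X B ->
  exists2 f : X -> R, continuous f & B = f @^-1` A.

Definition complete_for (R : realType) (Gamma : pointclass) (A : set R) : Prop :=
  Gamma R A /\ hard Gamma A.

(* For x in [0, 1), the coefficient of b^-(n+1); b-adic rationals get their
   terminating expansion. *)
Definition digit (R : realType) (b : nat) (x : R) (n : nat) : nat :=
  (Num.truncn (b%:R ^+ n.+1 * x) %% b)%N.

(* Overlapping occurrences are all counted, and each one lies entirely in t. *)
Definition occurrences (s t : seq nat) : nat :=
  count (fun i => prefix s (drop i t)) (iota 0 (size t).+1).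

Definition normal_numbers (R : realType) (b : nat) : set R :=
  [set x : R | 0 <= x < 1 /\
     forall s : seq nat, all (fun a => (a < b)%N) s ->
       (fun n : nat => (occurrences s (mkseq (digit b x) n))%:R / n%:R : R)
         @ \oo --> (b%:R ^- size s : R)].
Arguments normal_numbers : clear implicits.

(* Main.v *)
(* Stage k of the construction starts from an interval of length c^-n.  It chooses p with p/c^m
   inside that interval, m = K n, such that p/c^m has balanced digits: in base c up to place m,
   and in base b about twice as far as c^m numerators could fix digits.  Then it freezes a run
   of m/(j+1) zeros in base c, and after that a base-b run of zeros of relative length 1/(i+1).
   During the base-c run the point is so close to p/c^m that its base-b digits are those of
   p/c^m, hence balanced.  So with i = alpha(k) and j = beta(k) at stage k, the limit is
   b-normal iff alpha -> oo and, in that case, c-normal iff beta -> oo.  Every Pi^0_3 set of a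
   zero-dimensional Polish space is {x : alpha_x -> oo} for codes alpha_x(k) that are locally
   constant in x, which turns the construction into the required continuous reduction.

   A suitable p exists by counting.  Unbalanced words of length w have proportion at most
   C rho^w.  Digits in the first m places are handled conditionally on the current interval.
   For the later base-b digits, coprimality makes p |-> b^i p a permutation of Z/c^m, so the
   exceptional proportion among all p is about rho^(m/E), with 1/E the tolerated relative
   error; for large K this is below the density c^-n of the numerators in the current
   interval. *)
Require Import Defs.
From mathcomp Require Import all_boot all_order all_algebra.
From mathcomp Require Import all_classical all_reals all_analysis.
From mathcomp Require Import borel_hierarchy.
From mathcomp Require Import zify ring lra.

Set Implicit Arguments.
Unset Strict Implicit.
Unset Printing Implicit Defensive.

Import Order.TTheory GRing.Theory Num.Theory.
Import numFieldNormedType.Exports.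

Local Open Scope classical_set_scope.
Local Open Scope ring_scope.

(** * Exponentially few unbalanced words *)

Lemma sum_nat_block (V : nmodType) (F : nat -> V) (a b : nat) :
  \sum_(0 <= v < a * b) F v = \sum_(i < a) \sum_(j < b) F (i * b + j)%N.
Proof.
elim: a => [|a IH]; first by rewrite mul0n big_geq // big_ord0.
rewrite big_ord_recr -IH /= mulSnr (big_cat_nat (n := (a * b)%N)) ?leq_addr //=.
congr (_ + _); rewrite -{1}[(a * b)%N]add0n big_addn addKn big_mkord.
by apply: eq_bigr => j _; rewrite addnC.
Qed.

(** A word is coded by its value [v] and a block of length [k] by [sigma]. Positions count from the
    least significant digit, and blocks reaching past the top digit read zeros. *)
Definition hits (g k sigma w v : nat) : nat :=
  \sum_(j < w) ((v %/ g ^ j) %% g ^ k == sigma)%N.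

Lemma hits1_recl (B sigma q i j : nat) : (j < B)%N ->
  hits B 1 sigma q.+1 (i * B + j) = ((j == sigma) + hits B 1 sigma q i)%N.
Proof.
move=> jB; have B0 : (0 < B)%N by case: B jB.
rewrite /hits big_ord_recl expn0 divn1 expn1 modnMDl modn_small //.
congr addn; apply: eq_bigr => l _.
by rewrite /= /bump /= add1n expnS divnMA divnMDl // (divn_small jB) addn0.
Qed.

(** The generating function factors over the [q] independent digits: each contributes [lam] for the
    value [sigma] and 1 for the [B - 1] others. *)
Lemma sum_weight_hits1 (R : realFieldType) (lam : R) (B sigma q : nat) :
  (sigma < B)%N ->
  \sum_(0 <= v < B ^ q) lam ^+ hits B 1 sigma q v = (B%:R - 1 + lam) ^+ q.
Proof.
move=> sB; elim: q => [|q IH].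
  by rewrite expn0 big_nat1 /hits big_ord0 !expr0.
rewrite expnSr sum_nat_block exprS -IH mulr_sumr big_mkord.
apply: eq_bigr => i _.
under eq_bigr do rewrite hits1_recl // exprD.
rewrite -mulr_suml; congr (_ * _).
rewrite (bigD1 (Ordinal sB)) //= eqxx expr1 addrC; congr (_ + _).
rewrite (eq_bigr (fun=> 1)); last first.
  by move=> j jn; rewrite [_ == _](_ : _ = false) ?expr0 //; apply/negbTE.
rewrite sumr_const cardC1 card_ord -subn1 natrB //; exact: leq_ltn_trans sB.
Qed.

(** Positions [i*k + r] with [r] fixed see disjoint blocks, namely the base-[g^k] digits of
    [v %/ g^r]. *)
Lemma hits_le_residues (g k sigma w v Q : nat) :
  (0 < g)%N -> (0 < k)%N -> (w <= Q * k)%N ->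
  (hits g k sigma w v <= \sum_(r < k) hits (g ^ k) 1 sigma Q (v %/ g ^ r))%N.
Proof.
move=> g0 k0 wQ.
have -> : (\sum_(r < k) hits (g ^ k) 1 sigma Q (v %/ g ^ r) = hits g k sigma (Q * k) v)%N.
  rewrite /hits -[RHS](big_mkord xpredT (fun j => nat_of_bool (v %/ g ^ j %% g ^ k == sigma)%N)).
  rewrite sum_nat_block exchange_big /=; apply: eq_bigr => i _; apply: eq_bigr => j _.
  by rewrite -divnMA expn1 -expnM -expnD mulnC addnC.
rewrite /hits -!(big_mkord xpredT (fun j => nat_of_bool (v %/ g ^ j %% g ^ k == sigma)%N)).
by rewrite [leqRHS](big_cat_nat (n := w)) //= leq_addr.
Qed.

(** Frequency above [g^-k + 1/e], cleared of denominators. *)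
Definition overfull (e g k sigma w v : nat) : bool :=
  ((e + g ^ k) * w < e * g ^ k * hits g k sigma w v)%N.

Lemma bernoulli (R : realFieldType) (t : R) (n : nat) :
  -1 <= t -> 1 + t *+ n <= (1 + t) ^+ n.
Proof.
move=> t1; elim: n => [|n IH]; first by rewrite mulr0n addr0 expr0.
rewrite exprSr; apply: le_trans (ler_wpM2r _ IH); last by lra.
rewrite mulrSr -(mulr_natl t); have : 0 <= n%:R * t ^+ 2 by rewrite mulr_ge0 ?sqr_ge0.
nra.
Qed.

(** At [mu = 1] both sides equal [B], with derivatives [D < A * B], so the inequality holds just to
    the right of 1. *)
Lemma chernoff_base (R : realFieldType) (D A B : nat) : (0 < B)%N -> (D < A * B)%N ->
  exists mu : R, 1 < mu /\ B%:R - 1 + mu ^+ D < B%:R * mu ^+ A.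
Proof.
(* This [t] is so small that the second-order term [A * B * D * t] stays below the gap
   [A * B - D >= 1]. *)
move=> B0 DAB; pose n := (A * B * D.+1)%N; pose t : R := (n.*2.+2)%:R^-1.
have t0 : 0 < t by rewrite invr_gt0 ltr0n.
have tn : t * (n.*2.+2)%:R = 1 by rewrite mulVf // pnatr_eq0.
have t1 : t <= 1 by rewrite invf_le1 ?ltr0n // ler1n.
exists (1 + t); split; first by lra.
have h1 := @bernoulli _ t A ltac:(lra).
have h2 := @bernoulli _ (- t) D ltac:(lra).
(* Turns Bernoulli's lower bound for [(1 - t)^D] into an upper bound for [(1 + t)^D]. *)
have h3 : (1 + t) ^+ D * (1 - t) ^+ D <= 1.
  by rewrite -exprMn exprn_ile1 //; nra.
have hD : 1 + D%:R <= (A * B)%:R :> R by rewrite nat1r ler_nat.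
rewrite natrM in hD.
have nE : n%:R = A%:R * B%:R * (1 + D%:R) :> R by rewrite /n !natrM nat1r.
have nE2 : (n.*2.+2)%:R = 2 + 2 * n%:R :> R by rewrite -mul2n -addn2 natrD natrM; ring.
rewrite nE2 nE in tn.
rewrite -mulr_natl in h1; rewrite mulNrn -mulr_natl in h2.
have D0 : 0 <= D%:R :> R by []. have A0 : 0 <= A%:R :> R by [].
have B1 : 1 <= B%:R :> R by rewrite ler1n.
set d : R := D%:R in hD D0 h2 tn *; set a : R := A%:R in hD A0 h1 tn *.
set b : R := B%:R in hD B1 tn *; set X := (1 + t) ^+ D in h3 *.
set Y := (1 - t) ^+ D in h3 h2; set Z := (1 + t) ^+ A in h1 *.
have X0 : 0 <= X by rewrite exprn_ge0 //; lra.
have dt : 0 < 1 - d * t.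
  have : d * (1 + d) * t <= a * b * (1 + d) * t.
    apply: ler_wpM2r; first lra. apply: ler_wpM2r; lra.
  nra.
have h4 : X * (1 - d * t) <= 1 by apply: le_trans h3; apply: ler_wpM2l => //; lra.
have h5 : X < 1 + a * b * t.
  rewrite -(ltr_pM2r dt); apply: le_lt_trans h4 _.
  have : 0 < t * (a * b - d - a * b * d * t).
    apply: mulr_gt0 => //. have : d * (a * b * t) < 1; last by lra.
    have : 0 <= a * b * t by rewrite !mulr_ge0 //; lra.
    have : 2 * t + 2 * (a * b * t) * (1 + d) = 1 by apply: etrans tn; ring.
    set u := a * b * t; nra.
  nra.
have : b * (1 + a * t) <= b * Z by apply: ler_wpM2l => //; lra.
nra.
Qed.

Definition exp_small (R : realFieldType) (u : nat -> R) : Prop :=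
  exists C rho : R, [/\ 0 < C, 0 < rho, rho < 1 & forall w, u w <= C * rho ^+ w].

Lemma exp_small_add (R : realFieldType) (u v : nat -> R) :
  exp_small u -> exp_small v -> exp_small (fun w => u w + v w).
Proof.
move=> [C [r [C0 r0 r1 hu]]] [D [s [D0 s0 s1 hv]]].
exists (C + D), (Num.max r s); split; rewrite ?lt_max ?r0 ?gt_max ?r1 ?addr_gt0 // => w.
rewrite mulrDl; apply: lerD; [apply: le_trans (hu w) _|apply: le_trans (hv w) _];
  rewrite ler_pM2l // lerXn2r ?nnegrE ?le_max ?lexx ?orbT //; rewrite ?ltW //.
all: by rewrite ?r0 ?s0 ?orbT.
Qed.

Lemma exp_small_sum (R : realFieldType) (I : finType) (P : pred I) (u : I -> nat -> R) :
  (forall i, P i -> exp_small (u i)) -> exp_small (fun w => \sum_(i | P i) u i w).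
Proof.
move=> hu; rewrite (_ : (fun w => _) = \sum_(i | P i) u i); last first.
  by apply/funext => w; rewrite fct_sumE.
apply: (big_ind (@exp_small R)) => //; last exact: exp_small_add.
exists 1, 2^-1; split; rewrite ?invf_lt1 ?invr_gt0 ?ltr1n // => w.
by rewrite mulr_ge0 // exprn_ge0 ?invr_ge0.
Qed.

Lemma exp_small_le (R : realFieldType) (a : R) (u v : nat -> R) : 0 < a ->
  (forall w, u w <= a * v w) -> exp_small v -> exp_small u.
Proof.
move=> a0 uv [C [r [C0 r0 r1 hv]]]; exists (a * C), r; split; rewrite ?mulr_gt0 // => w.
by apply: le_trans (uv w) _; rewrite -mulrA ler_pM2l.
Qed.

Lemma sum_block_div (R : nmodType) (F : nat -> R) (a b : nat) : (0 < b)%N ->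
  \sum_(0 <= v < a * b) F (v %/ b)%N = (\sum_(0 <= v < a) F v) *+ b.
Proof.
move=> b0; rewrite sum_nat_block -sumrMnl big_mkord; apply: eq_bigr => i _.
rewrite (eq_bigr (fun=> F i)) ?sumr_const ?card_ord // => j _.
by rewrite divnMDl // divn_small ?addn0.
Qed.

(** Pigeonhole: if all [k] residue classes stayed within a [k]-th of the threshold, their sum could
    not exceed it. *)
Lemma overfull_residue (e g k sigma w v Q : nat) :
  (0 < g)%N -> (0 < k)%N -> (w <= Q * k)%N -> overfull e g k sigma w v ->
  exists r : 'I_k,
    ((e + g ^ k) * w < e * g ^ k * k * hits (g ^ k) 1 sigma Q (v %/ g ^ r))%N.
Proof.
move=> g0 k0 wQ ov; apply/existsP; apply: contraT; rewrite negb_exists => /forallP h.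
move: ov; rewrite /overfull ltnNge => /negP[].
apply: leq_trans (leq_mul (leqnn _) (hits_le_residues sigma v g0 k0 wQ)) _.
rewrite -(leq_pmul2r k0) mulnAC big_distrr /=.
apply: (@leq_trans (\sum_(r < k) (e + g ^ k) * w)%N); last first.
  by rewrite sum_nat_const card_ord mulnC.
by apply: leq_sum => i _; move: (h i); rewrite -leqNgt.
Qed.

(** Bernoulli's inequality at [1 - (1 - y)/k] replaces the [k]-th root in an arbitrary ordered
    field. *)
Lemma exp_root (R : realFieldType) (y : R) (k : nat) : (0 < k)%N -> 0 < y -> y < 1 ->
  exists rho : R, [/\ 0 < rho, rho < 1 & y <= rho ^+ k].
Proof.
move=> k0 y0 y1; have k1 : 1 <= k%:R :> R by rewrite ler1n.
have z0 : 0 < (1 - y) / k%:R by rewrite divr_gt0 //; lra.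
have z1 : (1 - y) / k%:R <= 1 - y by rewrite ler_pdivrMr; nra.
exists (1 + (- ((1 - y) / k%:R))); split; [lra|lra|].
apply: le_trans (@bernoulli R _ k _); last by lra.
by rewrite mulNrn -[_ *+ k]mulr_natr divfK ?pnatr_eq0 -?lt0n //; lra.
Qed.

Section chernoff.
Variables (R : realFieldType) (e g k sigma : nat).
Hypotheses (e0 : (0 < e)%N) (g0 : (1 < g)%N) (k0 : (0 < k)%N) (sg : (sigma < g ^ k)%N).

Let B := (g ^ k)%N.

(* Chernoff's bound: positions in one residue class mod k read independent base-g^k digits,
   and some class carries at least the average share of the hits. *)
Lemma exp_small_overfull :
  exp_small (fun w => (\sum_(0 <= v < g ^ w) overfull e g k sigma w v)%:R / (g ^ w)%:R : R).
Proof.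
have B0 : (0 < B)%N by rewrite expn_gt0 (ltnW g0).
have BR0 : 0 < B%:R :> R by rewrite ltr0n.
(* With these exponents [lam ^ hits] is at least [mu ^ ((e + B) * w)] for an overfull class, while
   its mean is [(L/B)^Q]; Markov's inequality then yields exponential decay. *)
have [mu [mu1 hmu]] := @chernoff_base R (e * B * k) ((e + B) * k) B B0
   ltac:(rewrite mulnAC; nia).
have mu0 : 0 < mu by lra.
pose lam := mu ^+ (e * B * k).
have lam1 : 1 <= lam by rewrite exprn_ege1 // ltW.
have B1 : 1 <= B%:R :> R by rewrite ler1n.
set L := B%:R - 1 + lam in hmu; have L0 : 0 < L by rewrite /L; lra.
pose M := mu ^+ ((e + B) * k); have M0 : 0 < M by rewrite exprn_gt0.
pose y := L / (B%:R * M); have BM0 : 0 < B%:R * M by rewrite mulr_gt0.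
have y0 : 0 < y by rewrite divr_gt0.
have y1 : y < 1 by rewrite ltr_pdivrMr // mul1r.
have [rho [rho0 rho1 yrho]] := exp_root k0 y0 y1.
exists ((k * g ^ k * g ^ k)%:R * M), rho; split => //.
  by rewrite mulr_gt0 // ltr0n !muln_gt0 k0 expn_gt0 (ltnW g0).
move=> w; have gw0 : 0 < (g ^ w)%:R :> R by rewrite ltr0n expn_gt0 (ltnW g0).
rewrite ler_pdivrMr //.
pose Q := (w %/ k).+1.
have wQ : (w <= Q * k)%N by rewrite ltnW // ltn_ceil.
have Qw : (Q * k <= w + k)%N by rewrite mulSnr leq_add2r leq_trunc_div.
have markov (r : 'I_k) (v : nat) :
    ((e + B) * w < e * B * k * hits B 1 sigma Q (v %/ g ^ r))%N%:R * mu ^+ ((e + B) * w)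
      <= lam ^+ hits B 1 sigma Q (v %/ g ^ r).
  case: ltnP => h; last by rewrite mul0r exprn_ge0 // (le_trans _ lam1).
  by rewrite mul1r /lam -exprM ler_eXn2l // ltnW.
have step : (\sum_(0 <= v < g ^ w) overfull e g k sigma w v)%:R * mu ^+ ((e + B) * w)
     <= (k * g ^ k)%:R * L ^+ Q.
  rewrite natr_sum mulr_suml.
  apply: (@le_trans _ _ (\sum_(0 <= v < g ^ w) \sum_(r < k)
      lam ^+ hits B 1 sigma Q (v %/ g ^ r))).
    apply: ler_sum => v _; case: (boolP (overfull _ _ _ _ _ _)) => [ov|_]; last first.
      by rewrite mul0r sumr_ge0 // => r _; rewrite exprn_ge0 // (le_trans _ lam1).
    have [r hr] := overfull_residue (ltnW g0) k0 wQ ov.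
    have := markov r v; rewrite hr !mul1r => /le_trans; apply.
    rewrite (bigD1 r) //= lerDl sumr_ge0 // => r' _.
    by rewrite exprn_ge0 // (le_trans _ lam1).
  rewrite exchange_big /=.
  apply: (@le_trans _ _ (\sum_(r < k) L ^+ Q *+ g ^ k)); last first.
    by rewrite sumr_const card_ord -mulrnA -[leLHS]mulr_natl mulnC.
  apply: ler_sum => r _.
  (* On the enlarged range [v %/ g^r] takes each value below [B^Q] exactly [g^r] times. *)
  apply: (@le_trans _ _ (\sum_(0 <= v < B ^ Q * g ^ r) lam ^+ hits B 1 sigma Q (v %/ g ^ r))).
    rewrite [leRHS](big_cat_nat (n := (g ^ w)%N)) //=; last first.
      by rewrite -expnM -expnD leq_pexp2l ?(ltnW g0) // mulnC (leq_trans wQ) // leq_addr.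
    by rewrite lerDl sumr_ge0 // => v _; rewrite exprn_ge0 // (le_trans _ lam1).
  rewrite (sum_block_div (fun v => lam ^+ hits B 1 sigma Q v)) ?expn_gt0 ?(ltnW g0) //.
  rewrite sum_weight_hits1 // -/L ler_wpMn2l ?exprn_ge0 ?ltW //.
  by rewrite leq_pexp2l ?(ltnW g0) // ltnW.
have muw0 : 0 < mu ^+ ((e + B) * w) by rewrite exprn_gt0.
rewrite -(ler_pM2r muw0); apply: le_trans step _.
have LE : L = B%:R * y * M by rewrite /y; field; rewrite !gt_eqF.
clearbody y; rewrite LE !exprMn.
have h1 : B%:R ^+ Q <= (g ^ w)%:R * (g ^ k)%:R :> R.
  by rewrite -natrX -natrM ler_nat -expnM -expnD leq_pexp2l ?(ltnW g0) // mulnC.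
have h2 : y ^+ Q <= rho ^+ w.
  apply: (@le_trans _ _ ((rho ^+ k) ^+ Q)).
    by rewrite lerXn2r ?nnegrE ?exprn_ge0 // ltW.
  by rewrite -exprM ler_wiXn2l ?ltW // mulnC.
have h3 : M ^+ Q <= mu ^+ ((e + B) * w) * M.
  rewrite /M -exprM -exprD ler_weXn2l ?ltW // -mulnA -mulnDr leq_mul2l.
  by rewrite mulnC Qw orbT.
rewrite [leRHS](_ : _ = (k * g ^ k)%:R * ((g ^ w)%:R * (g ^ k)%:R * rho ^+ w *
   (mu ^+ ((e + B) * w) * M))); last by rewrite !natrM; ring.
have n1 : 0 <= B%:R ^+ Q :> R by rewrite exprn_ge0.
have n2 : 0 <= y ^+ Q by rewrite exprn_ge0 // ltW.
have n3 : 0 <= M ^+ Q by rewrite exprn_ge0 // ltW.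
rewrite ler_wpM2l //; apply: ler_pM => //; first exact: mulr_ge0.
exact: ler_pM.
Qed.
End chernoff.

(** One parameter bounds the block length and, as [1/E], the tolerance, so letting [E] grow covers
    every block and every error. With [E = 0] no word is unbalanced. *)
Definition unbalanced (E g w v : nat) : bool :=
  [exists k : 'I_E.+1, [exists sigma : 'I_(g ^ k), (0 < k)%N && overfull E g k sigma w v]].

(** Union bound over the pairs [(k, sigma)], whose number is independent of [w]. *)
Lemma exp_small_unbalanced (R : realFieldType) (E g : nat) : (1 < g)%N ->
  exp_small (fun w => (\sum_(0 <= v < g ^ w) unbalanced E g w v)%:R / (g ^ w)%:R : R).
Proof.
move=> g1.
have h : exp_small (fun w => \sum_(k < E.+1 | (0 < k)%N) \sum_(sigma < g ^ k)
   ((\sum_(0 <= v < g ^ w) overfull E g k sigma w v)%:R / (g ^ w)%:R : R)).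
  apply: exp_small_sum => k k0; apply: exp_small_sum => s _.
  by apply: exp_small_overfull; rewrite // (leq_trans k0) // -ltnS.
apply: (exp_small_le (a := 1) _ _ h) => // w; rewrite mul1r.
under [leRHS]eq_bigr do rewrite -mulr_suml -natr_sum.
rewrite -mulr_suml -natr_sum ler_wpM2r ?invr_ge0 // ler_nat.
under [leqRHS]eq_bigr do rewrite exchange_big.
rewrite [leqRHS]exchange_big; apply: leq_sum => v _.
case: (boolP (unbalanced _ _ _ _)) => // /existsP[k /existsP[s /andP[k0 ov]]].
by rewrite (bigD1 k) //= (bigD1 s) //= ov.
Qed.

(** * Numerators with balanced expansions *)

Lemma sum_nat_pred_le (S : pred nat) (a F P Q : nat) :
  (forall p, S p -> (a <= p < a + F)%N) -> (\sum_(P <= p < Q) S p <= F)%N.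
Proof.
move=> h; rewrite -(big_mkcond S (fun=> 1%N)) sum1_count -size_filter -(size_iota a F).
apply: uniq_leq_size; first by rewrite filter_uniq // iota_uniq.
by move=> p; rewrite mem_filter mem_iota => /andP[/h].
Qed.

Lemma sum_nat_blockN (F : nat -> nat) (a b : nat) :
  (\sum_(0 <= v < a * b) F v = \sum_(i < a) \sum_(j < b) F (i * b + j))%N.
Proof. exact: sum_nat_block. Qed.

(** [L %/ W + 2] full periods cover any interval of length [L]. *)
Lemma sum_nat_modn (V : nat -> nat) (t0 L W : nat) : (0 < W)%N ->
  (\sum_(t0 <= t < t0 + L) V (t %% W) <= (L %/ W + 2) * \sum_(0 <= v < W) V v)%N.
Proof.
move=> W0; set q := (t0 %/ W)%N; set n := (L %/ W + 2)%N.
have h0 : (q * W <= t0)%N by exact: leq_trunc_div.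
have h1 : (t0 < q.+1 * W)%N by exact: ltn_ceil.
have h2 : (L < (L %/ W).+1 * W)%N by exact: ltn_ceil.
have h3 : (t0 + L <= n * W + q * W)%N by rewrite /n; nia.
have -> : (n * \sum_(0 <= v < W) V v = \sum_(q * W <= t < n * W + q * W) V (t %% W))%N.
  rewrite -{1}[(q * W)%N]add0n big_addn addnK sum_nat_blockN.
  rewrite [RHS](eq_bigr (fun=> \sum_(0 <= v < W) V v)%N) => [|i _]; last first.
    rewrite big_mkord; apply: eq_bigr => j _.
    by rewrite -addnA modnMDl addnC modnMDl modn_small.
  by rewrite sum_nat_const card_ord.
rewrite [leqRHS](big_cat_nat (n := t0)) ?(leq_trans _ h3) ?leq_addr //=.
apply: leq_trans (leq_addl _ _).
by rewrite [leqRHS](big_cat_nat (n := (t0 + L)%N)) ?leq_addr //=.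
Qed.

(** Each value of [(G * p) %/ M] is taken at most [M %/ G + 1] times, and the values lie in an
    interval of length [(G * U) %/ M + 2], to which [sum_nat_modn] applies. *)
Lemma count_affine (G M W d P U : nat) (V : pred nat) :
  (0 < G)%N -> (0 < M)%N -> (0 < W)%N ->
  (\sum_(P <= p < P + U) V (((G * p) %/ M + d) %% W)%N <=
   (M %/ G).+1 * (((G * U) %/ M + 2) %/ W + 2) * \sum_(0 <= v < W) V v)%N.
Proof.
move=> G0 M0 W0; set L := ((G * U) %/ M + 2)%N; set t0 := ((G * P) %/ M + d)%N.
rewrite -mulnA; apply: leq_trans (leq_mul (leqnn _) (sum_nat_modn (fun v => V v) t0 L W0)).
apply: (@leq_trans (\sum_(P <= p < P + U) \sum_(t0 <= t < t0 + L)
   ((G * p) %/ M + d == t) * V (t %% W))%N).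
  rewrite big_nat [leqRHS]big_nat; apply: leq_sum => p /andP[Pp pU].
  have h1 : ((G * P) %/ M <= (G * p) %/ M)%N by rewrite leq_div2r // leq_mul2l Pp orbT.
  have h2 : ((G * p) %/ M < (G * P) %/ M + L)%N.
    rewrite ltn_divLR // /L.
    have := ltn_ceil (G * P)%N M0; have := ltn_ceil (G * U)%N M0.
    have : (G * p <= G * P + G * U)%N by rewrite -mulnDr leq_mul2l (ltnW pU) orbT.
    nia.
  rewrite (bigD1_seq ((G * p) %/ M + d)%N) ?iota_uniq //=.
    by rewrite eqxx mul1n leq_addr.
  by rewrite mem_index_iota /t0; lia.
rewrite exchange_big big_distrr /=; apply: leq_sum => t _.
rewrite -big_distrl /= leq_mul2r; apply/orP; right.
(* Adding [G.-1] makes this a ceiling: the fibre over [t] starts at the least [p] with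
   [G * p >= (t - d) * M]. *)
apply: (@sum_nat_pred_le _ (((t - d) * M + G.-1) %/ G)%N) => p /eqP <-.
rewrite addnK; set a := (_ %/ G)%N.
have := leq_trunc_div (G * p) M; have := ltn_ceil (G * p)%N M0.
have := ltn_ceil M G0.
have := leq_trunc_div ((G * p) %/ M * M + G.-1) G; rewrite -/a.
have := ltn_ceil ((G * p) %/ M * M + G.-1)%N G0; rewrite -/a.
set q := (G * p %/ M)%N; set x := (M %/ G)%N; clearbody a q x.
move=> *; nia.
Qed.

Lemma sum_nat_mul_modn (b i M : nat) (F : nat -> nat) : coprime b M ->
  (\sum_(0 <= p < M) F ((b ^ i * p) %% M) = \sum_(0 <= q < M) F q)%N.
Proof.
case: M => [|M] cop; first by rewrite !big_geq.
rewrite !big_mkord [RHS](reindex_inj (h := fun p : 'I_M.+1 => inord ((b ^ i * p) %% M.+1))).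
  by apply: eq_bigr => p _; rewrite inordK ?ltn_mod.
move=> p q /(congr1 val); rewrite /= !inordK ?ltn_mod // => /eqP h.
have c : coprime (b ^ i) M.+1 by exact: coprimeXl.
apply: val_inj; move: h; wlog pq : p q / (p <= q)%N => [H|].
  by case: (leqP p q) => [|/ltnW] /H // {}H; rewrite eq_sym => /H.
rewrite eq_sym eqn_mod_dvd ?leq_mul2l ?pq ?orbT // -mulnBr Gauss_dvdr; last by rewrite coprime_sym.
move=> /dvdn_leq; case: (posnP (q - p)) => [|_ /(_ isT)].
  by move=> /eqP; rewrite subn_eq0 => qp _; apply/eqP; rewrite eqn_leq pq.
by move=> h; have := ltn_ord q; lia.
Qed.

Lemma exp_lt_eventually (R : archiRealFieldType) (rho a : R) : 0 < rho -> rho < 1 -> 0 < a ->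
  exists k0, forall k, (k0 <= k)%N -> rho ^+ k < a.
Proof.
move=> r0 r1 a0; pose t := rho^-1 - 1.
have t0 : 0 < t by rewrite subr_gt0 invf_gt1.
exists (Num.truncn (a^-1 / t)).+1 => k hk.
rewrite -ltf_pV2 ?posrE ?exprn_gt0 // -exprVn (_ : rho^-1 = 1 + t) /t; last by ring.
apply: lt_le_trans (bernoulli _ _); last by rewrite -/t; lra.
rewrite -/t -[t *+ k]mulr_natl -ltrBlDl; apply: (@lt_trans _ _ a^-1); first by lra.
rewrite -ltr_pdivrMr //; apply: lt_le_trans (truncnS_gt _) _.
by rewrite ler_nat.
Qed.

Lemma geometric_tail_le (R : realFieldType) (rho : R) (a W : nat) : 0 < rho -> rho < 1 ->
  \sum_(a <= w < W) rho ^+ w <= rho ^+ a / (1 - rho).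
Proof.
move=> r0 r1; have h : 0 < 1 - rho by lra.
rewrite ler_pdivlMr //; have [aW|/ltnW aW] := leqP a W; last first.
  by rewrite big_geq // mul0r exprn_ge0 // ltW.
have -> : (\sum_(a <= w < W) rho ^+ w) * (1 - rho) = rho ^+ a - rho ^+ W.
  rewrite mulr_suml -[RHS]opprB -(telescope_sumr (fun w => rho ^+ w)) // -sumrN.
  by apply: eq_bigr => w _; rewrite exprS; ring.
by rewrite gerBl exprn_ge0 // ltW.
Qed.

(* Both (t + 0) and (t + 1) are tested because a real number slightly above a rational
   may pick up one carry. *)
Definition balanced (E g w t : nat) : bool :=
  [forall d : 'I_2, ~~ unbalanced E g w ((t + d) %% g ^ w)%N].

(* The two clauses concern windows starting where the interval of length c^-n stops fixing
   digits, and base-b windows starting where p/c^m has exhausted its c^m choices. *)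
Definition good (b c E n m p : nat) : Prop :=
  (forall g, g \in [:: b; c] -> forall w, (up_log g (c ^ n) <= E * w)%N ->
     (g ^ (up_log g (c ^ n) + w) <= c ^ m)%N ->
     balanced E g w ((g ^ (up_log g (c ^ n) + w) * p) %/ c ^ m)) /\
  (forall w, (trunc_log b (c ^ m) <= E * w)%N -> (b ^ w <= c ^ m)%N ->
     balanced E b w ((b ^ (trunc_log b (c ^ m) + w) * p) %/ c ^ m)).

(** * Union bound over the tested windows *)

Section windows.
Variables (E g N M : nat).

(** The number of bad events at [p]. If the total over some candidates is below their number, one
    candidate has none. *)
Definition failures (cond : pred nat) (W p : nat) : nat :=
  \sum_(0 <= w < W | cond w) \sum_(d < 2)
    unbalanced E g w (((g ^ (N + w) * p) %/ M + d) %% g ^ w)%N.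

Lemma failures_eq0 (cond : pred nat) (W p w : nat) : failures cond W p = 0%N ->
  cond w -> (w < W)%N -> balanced E g w ((g ^ (N + w) * p) %/ M).
Proof.
move=> /eqP; rewrite /failures big_mkord sum_nat_eq0 => /forallP h cw wW.
have /implyP/(_ cw) := h (Ordinal wW); rewrite sum_nat_eq0 => /forallP h2.
by apply/forallP => d; have := h2 d; rewrite /= eqb0.
Qed.

(** Geometric series over the lengths [w >= w0]; the factor 2 accounts for the two carries [d]. *)
Lemma sum_failures_le (R : realFieldType) (a rho : R) (cond : pred nat) (W w0 P Q : nat) :
  0 < a -> 0 < rho -> rho < 1 -> (forall w, cond w -> (w0 <= w)%N) ->
  (forall w d, cond w -> (\sum_(P <= p < Q)
    unbalanced E g w (((g ^ (N + w) * p) %/ M + d) %% g ^ w)%N)%:R <= a * rho ^+ w) ->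
  (\sum_(P <= p < Q) failures cond W p)%:R <= 2 * a * (rho ^+ w0 / (1 - rho)).
Proof.
move=> a0 r0 r1 hw0 h; rewrite exchange_big /=.
apply: (@le_trans _ _ (\sum_(0 <= w < W | cond w) 2 * a * rho ^+ w)).
  rewrite natr_sum; apply: ler_sum => w cw.
  rewrite exchange_big /= natr_sum !big_ord_recl big_ord0.
  have := h w 0 cw; have := h w 1 cw; rewrite /=; lra.
rewrite -mulr_sumr; apply: ler_wpM2l; first by rewrite mulr_ge0 // ltW.
apply: le_trans (geometric_tail_le w0 W r0 r1).
rewrite [leLHS]big_mkcond [leRHS](big_nat_widenl _ 0) //= [leRHS]big_mkcond /=.
apply: ler_sum => w _; case: ifPn => [/hw0 ->|_] //.
by case: ifP => // _; rewrite exprn_ge0 // ltW.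
Qed.

End windows.

Lemma expn_up_log_le (g x : nat) : (1 < g)%N -> (0 < x)%N -> (g ^ up_log g x <= g * x)%N.
Proof.
move=> g1 x0; have [x1|x1] := leqP x 1.
  by have -> : x = 1%N by [lia]; rewrite up_log1 expn0 muln1 ltnW.
have : (0 < up_log g x)%N by rewrite up_log_gt0 g1 x1.
by have := up_log_gtn g1 x1; case: (up_log g x) => //= k h _; rewrite expnS leq_mul2l (ltnW h) orbT.
Qed.

Lemma expn_mono (m n e : nat) : (m <= n)%N -> (m ^ e <= n ^ e)%N.
Proof. by case: e => // e mn; rewrite leq_exp2r. Qed.

(** With [N] the logarithm, [2^n <= c^n <= g^N <= 2^(g*N)]. Such crude comparisons replace ratios of
    real logarithms throughout. *)
Lemma leq_mul_up_log (g c n : nat) : (1 < g)%N -> (1 < c)%N -> (n <= g * up_log g (c ^ n))%N.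
Proof.
move=> g1 c1; rewrite -(@leq_exp2l 2) // expnM.
apply: (leq_trans (expn_mono n c1)); apply: leq_trans (up_logP _ g1) _.
exact: expn_mono (ltnW (ltn_expl _ _)).
Qed.

Section terms.
Variables (R : realFieldType) (C rho : R) (E : nat).

(** As [p] runs through [U] consecutive numerators, [p/c^m] sweeps a length [c^-(n+1)], which is
    [g^-N] up to a constant factor. So the [w] digits after place [N] meet each word at most a
    bounded multiple of its fair share of times. *)
Lemma fresh_window_le (g c n m w d P : nat) : (1 < g)%N -> (1 < c)%N -> (n < m)%N ->
  let N := up_log g (c ^ n) in let U := (c ^ (m - n).-1)%N in
  (\sum_(0 <= v < g ^ w) unbalanced E g w v)%:R / (g ^ w)%:R <= C * rho ^+ w ->
  (g ^ (N + w) <= c ^ m)%N ->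
  (\sum_(P <= p < P + U)
    unbalanced E g w (((g ^ (N + w) * p) %/ c ^ m + d) %% g ^ w)%N)%:R
  <= (2 * (g + 4) * c)%:R * C * U%:R * rho ^+ w.
Proof.
move=> g1 c1 nm N U hS GM; set S := (\sum_(0 <= v < g ^ w) _)%N in hS.
have g0 := ltnW g1; have c0 := ltnW c1.
have gw0 : (0 < g ^ w)%N by rewrite expn_gt0 g0.
have G0 : (0 < g ^ (N + w))%N by rewrite expn_gt0 g0.
have M0 : (0 < c ^ m)%N by rewrite expn_gt0 c0.
have ME : (c ^ m = c ^ n * c * U)%N by rewrite /U -expnSr -expnD; congr expn; lia.
have NU : (g ^ N <= g * c ^ n)%N by rewrite expn_up_log_le // expn_gt0 c0.
have NL : (c ^ n <= g ^ N)%N by rewrite up_logP.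
have := count_affine d P U (unbalanced E g w) G0 M0 gw0; rewrite -/S.
set X := (\sum_(P <= p < _) _)%N; set G := (g ^ (N + w))%N in GM G0 *.
have GE : (G = g ^ N * g ^ w)%N by rewrite /G expnD.
have h1 : ((G * U) %/ c ^ m <= g * g ^ w)%N.
  apply: leq_trans (_ : ((g * g ^ w) * c ^ m) %/ c ^ m <= _)%N; last by rewrite mulnK.
  rewrite leq_div2r // GE ME.
  have : (g ^ N * g ^ w * U <= (g * c ^ n) * g ^ w * U)%N by rewrite !leq_mul2r NU !orbT.
  have : (g * c ^ n * g ^ w * U <= g * c ^ n * g ^ w * U * c)%N by rewrite leq_pmulr.
  lia.
have h2 : (((G * U) %/ c ^ m + 2) %/ g ^ w + 2 <= g + 4)%N.
  have : (((G * U) %/ c ^ m + 2) %/ g ^ w <= (g * g ^ w + 2) %/ g ^ w)%N.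
    by rewrite leq_div2r // leq_add2r.
  rewrite divnMDl //; have := leq_div2l 2 (isT : (0 < 1)%N) gw0; rewrite divn1; lia.
have h3 : ((c ^ m %/ G).+1 * G <= 2 * c ^ m)%N.
  by have := leq_trunc_div (c ^ m) G; lia.
move=> h4.
have h5 : (X * (c ^ n * g ^ w) <= (2 * (g + 4) * c) * U * S * c ^ n)%N.
  apply: (@leq_trans (X * G)); first by rewrite leq_mul2l GE leq_mul2r NL !orbT.
  apply: leq_trans (leq_mul h4 (leqnn G)) _.
  apply: (@leq_trans ((c ^ m %/ G).+1 * G * (g + 4) * S)).
    by rewrite mulnAC leq_mul2r; apply/orP; right; rewrite mulnAC leq_mul2l h2 orbT.
  apply: (@leq_trans (2 * c ^ m * (g + 4) * S)); first by rewrite !leq_mul2r h3 !orbT.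
  by rewrite ME; apply/eq_leq; ring.
have h6 : (X * g ^ w <= (2 * (g + 4) * c) * U * S)%N.
  by rewrite -(@leq_pmul2r (c ^ n)) ?expn_gt0 ?c0 // -mulnA [(g ^ w * _)%N]mulnC.
have gwR : 0 < (g ^ w)%:R :> R by rewrite ltr0n.
rewrite -(ler_pM2r gwR) -natrM.
apply: (@le_trans _ _ (((2 * (g + 4) * c) * U * S)%N%:R)); first by rewrite ler_nat.
rewrite ler_pdivrMr // in hS.
rewrite natrM natrM -!mulrA; apply: ler_wpM2l => //.
rewrite mulrCA; apply: ler_wpM2l => //.
by apply: le_trans hS _; rewrite mulrA.
Qed.

(* [p |-> b^i p] permutes Z/M, so every base-b window of p/M, however far, is equidistributed
   over p. *)
Lemma periodic_window_le (b M i w d P Q : nat) : (1 < b)%N -> (0 < M)%N -> coprime b M ->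
  (\sum_(0 <= v < b ^ w) unbalanced E b w v)%:R / (b ^ w)%:R <= C * rho ^+ w ->
  (b ^ w <= M)%N -> (Q <= M)%N ->
  (\sum_(P <= p < Q) unbalanced E b w (((b ^ (i + w) * p) %/ M + d) %% b ^ w)%N)%:R
  <= 10 * C * M%:R * rho ^+ w.
Proof.
move=> b1 M0 cop hS bM QM; set S := (\sum_(0 <= v < b ^ w) _)%N in hS.
have bw0 : (0 < b ^ w)%N by rewrite expn_gt0 ltnW.
(* The [w] digits after place [i] depend only on the residue of [b^i * p] modulo [M]. *)
have shift p : ((((b ^ (i + w) * p) %/ M + d) %% b ^ w) =
   (((b ^ w * ((b ^ i * p) %% M)) %/ M + d) %% b ^ w))%N.
  rewrite expnD mulnAC [(b ^ i * p)%N in LHS](divn_eq _ M) mulnDl -mulnA [(M * _)%N]mulnC mulnA.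
  by rewrite divnMDl // -addnA modnMDl [(_ %% M * _)%N]mulnC.
set X := (\sum_(P <= p < Q) _)%N.
have h0 : (X <= \sum_(0 <= p < 0 + M)
     unbalanced E b w (((b ^ w * p) %/ M + d) %% b ^ w))%N.
  rewrite add0n -(sum_nat_mul_modn i
    (fun q => nat_of_bool (unbalanced E b w (((b ^ w * q) %/ M + d) %% b ^ w))) cop).
  under [leqRHS]eq_bigr do rewrite -shift.
  have [PQ|/ltnW QP] := leqP P Q; last by rewrite /X big_geq.
  rewrite [leqRHS](big_cat_nat (n := Q)) //= (leq_trans _ (leq_addr _ _)) //.
  by rewrite [leqRHS](big_cat_nat (n := P)) //= leq_addl.
have := count_affine d 0 M (unbalanced E b w) bw0 M0 bw0; rewrite -/S mulnK //.
have -> : ((b ^ w + 2) %/ b ^ w = 2 %/ b ^ w + 1)%N by rewrite -{1}[(b ^ w)%N]mul1n divnMDl // addnC.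
have h2 : (2 %/ b ^ w <= 2)%N by have := leq_div2l 2 (isT : (0 < 1)%N) bw0; rewrite divn1.
move=> h3; have h4 := leq_trans h0 h3.
have h5 : (X * b ^ w <= 10 * M * S)%N.
  have h6 : ((M %/ b ^ w).+1 * b ^ w <= 2 * M)%N.
    by have := leq_trunc_div M (b ^ w); lia.
  apply: leq_trans (leq_mul h4 (leqnn _)) _.
  apply: (@leq_trans ((M %/ b ^ w).+1 * b ^ w * 5 * S)).
    by rewrite mulnAC leq_mul2r mulnAC leq_mul2l; apply/orP; right; apply/orP; right; lia.
  by apply: (@leq_trans (2 * M * 5 * S)); [rewrite !leq_mul2r h6 !orbT|lia].
have bwR : 0 < (b ^ w)%:R :> R by rewrite ltr0n.
rewrite -(ler_pM2r bwR) -natrM.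
apply: (@le_trans _ _ ((10 * M * S)%N%:R)); first by rewrite ler_nat.
rewrite ler_pdivrMr // in hS.
rewrite !natrM -!mulrA; apply: ler_wpM2l => //.
rewrite mulrCA; apply: ler_wpM2l => //.
by apply: le_trans hS _; rewrite mulrA.
Qed.

End terms.

Lemma ltn_mul_trunc_log (b x : nat) (m : nat) : (1 < b)%N -> (2 ^ m <= x)%N ->
  (m < b * (trunc_log b x).+1)%N.
Proof.
move=> b1 mx; rewrite -(@ltn_exp2l 2) // expnM.
apply: leq_ltn_trans mx _; apply: leq_trans (trunc_log_ltn _ b1) _.
exact: expn_mono (ltnW (ltn_expl _ _)).
Qed.

(** Of [U] consecutive candidates one is good, because the bad events over all of them total less
    than [U]. *)
Lemma exists_good (R : archiRealFieldType) (b c E : nat) : (1 < b)%N -> (1 < c)%N -> coprime b c -> (0 < E)%N ->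
  exists K N0 : nat, [/\ (E < K)%N,
    forall n, (E * n <= trunc_log b (c ^ (K * n)))%N &
    forall n, (N0 <= n)%N -> forall P, (P + c ^ (K * n - n).-1 <= c ^ (K * n))%N ->
      exists p, (P <= p < P + c ^ (K * n - n).-1)%N /\ good b c E n (K * n) p].
Proof.
move=> b1 c1 cop E0.
have [C [rho [C0 r0 r1 hC]]] := exp_small_add (exp_small_unbalanced R E b1)
  (exp_small_unbalanced R E c1).
have hS g : g \in [:: b; c] -> forall w,
    (\sum_(0 <= v < g ^ w) unbalanced E g w v)%:R / (g ^ w)%:R <= C * rho ^+ w.
  by rewrite !inE => /orP[/eqP->|/eqP->] w; apply: le_trans (hC w); rewrite ?lerDl ?lerDr divr_ge0.
have b0 := ltnW b1; have c0 := ltnW c1.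
have cR : 0 < (2 * c)%:R :> R by rewrite ltr0n; lia.
have [k0 hk0] : exists k0, forall k, (k0 <= k)%N -> rho ^+ k < (2 * c)%:R^-1.
  by apply: exp_lt_eventually => //; rewrite invr_gt0.
(* This [K] forces the far base-[b] windows to have length at least [K' * n]. Their exceptional
   share is of order [rho^(K' n) <= (2c)^-n], which is smaller than the density [c^-(n+1)] of the
   candidates by a factor of order [2^-n]. *)
pose K' := k0.+1; pose K := (b * (E * K' + 1))%N.
have hK n : ((E * K' + 1) * n <= trunc_log b (c ^ (K * n)))%N.
  have : (2 ^ (K * n) <= c ^ (K * n))%N by exact: expn_mono.
  by move=> /(ltn_mul_trunc_log b1); rewrite /K -mulnA ltn_pmul2l // ltnS.
have r10 : 0 < 1 - rho by rewrite subr_gt0.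
pose A g := (2 * (g + 4) * c)%N.
have A0 g : 0 < (A g)%:R :> R by rewrite ltr0n !muln_gt0 c0 andbT; lia.
have AA0 : 0 < (A b)%:R + (A c)%:R :> R by rewrite addr_gt0.
(* The 8 here and the 80 below allot [U/4] to the fresh windows and [U/4] to the far ones. *)
have [k1 hk1] : exists k1, forall k, (k1 <= k)%N ->
    rho ^+ k < (1 - rho) / (8 * ((A b)%:R + (A c)%:R) * C).
  by apply: exp_lt_eventually => //; rewrite divr_gt0 // !mulr_gt0.
have [k2 hk2] : exists k2, forall k, (k2 <= k)%N -> 2^-1 ^+ k < (1 - rho) / (80 * C * c%:R).
  apply: exp_lt_eventually; rewrite ?invf_lt1 ?invr_gt0 ?ltr1n //.
  by rewrite divr_gt0 // !mulr_gt0 // ltr0n.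
exists K, (k1 * (b * c * E) + k2 + 1)%N; split.
- by rewrite /K /K'; nia.
- by move=> n; apply: leq_trans (hK n); rewrite /K'; nia.
move=> n hn P; set m := (K * n)%N; set U := (c ^ (m - n).-1)%N => PU.
have nm : (n < m)%N by rewrite /m /K /K'; nia.
set M := (c ^ m)%N in PU *; have M0 : (0 < M)%N by rewrite expn_gt0 c0.
have ME : (M = c ^ n * c * U)%N by rewrite /M /U -expnSr -expnD; congr expn; lia.
have U0 : 0 < U%:R :> R by rewrite ltr0n expn_gt0 c0.
pose N g := up_log g (c ^ n); set i := trunc_log b M.
pose condA g := [pred w | (N g <= E * w) && (g ^ (N g + w) <= M)]%N.
pose condB := [pred w | (i <= E * w) && (b ^ w <= M)]%N.
(* [N g <= E * w] and [n <= g * N g] give [w >= n/(g E)]; this [w0] serves both bases. *)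
pose w0 := (n %/ (b * c * E))%N.
have hA g : g \in [:: b; c] ->
   (\sum_(P <= p < P + U) failures E g (N g) M (condA g) M p)%:R <=
      2 * ((A g)%:R * C * U%:R) * (rho ^+ w0 / (1 - rho)).
  move=> gbc; have g1 : (1 < g)%N by move: gbc; rewrite !inE => /orP[/eqP->|/eqP->].
  apply: sum_failures_le => //; first by rewrite !mulr_gt0.
    move=> w /= /andP[h _]; rewrite /w0.
    have := leq_mul_up_log n g1 c1; rewrite -/(N g) => h2.
    apply: (@leq_trans ((b * c * E * w) %/ (b * c * E))); last by rewrite mulKn // !muln_gt0 b0 c0.
    apply: leq_div2r; have : (g * N g <= g * (E * w))%N by rewrite leq_mul2l h orbT.
    by move: gbc; rewrite !inE => /orP[/eqP gE|/eqP gE]; rewrite gE in h2 *; nia.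
  by move=> w d /= /andP[_ h]; apply: fresh_window_le => //; apply: hS.
have hB : (\sum_(P <= p < P + U) failures E b i M condB M p)%:R <=
      2 * (10 * C * M%:R) * (rho ^+ (K' * n) / (1 - rho)).
  apply: sum_failures_le => //; first by rewrite !mulr_gt0 // ltr0n.
    move=> w /= /andP[h _]; rewrite -(leq_pmul2l E0) (leq_trans _ h) //.
    by apply: leq_trans (hK n); nia.
  move=> w d /= /andP[_ h]; apply: periodic_window_le => //.
    exact: coprimeXr.
  by apply: hS; rewrite inE eqxx.
have hrho : rho ^+ w0 / (1 - rho) < (8 * ((A b)%:R + (A c)%:R) * C)^-1.
  rewrite ltr_pdivrMr // mulrC; apply: hk1.
  by rewrite /w0 leq_divRL ?muln_gt0 ?b0 ?c0 //; lia.
have hrho2 : M%:R * (rho ^+ (K' * n) / (1 - rho)) < U%:R / (80 * C).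
  have h1 : rho ^+ (K' * n) <= ((2 * c)%:R^-1) ^+ n.
    by rewrite exprM lerXn2r ?nnegrE ?invr_ge0 ?exprn_ge0 ?ltW // hk0.
  have h2 : M%:R * (2 * c)%:R^-1 ^+ n = c%:R * U%:R * 2^-1 ^+ n :> R.
    rewrite ME !natrM natrX invfM exprMn.
    have h : c%:R ^+ n * c%:R^-1 ^+ n = 1 :> R by rewrite -exprMn divff ?expr1n // pnatr_eq0 -lt0n.
    move: (c%:R ^+ n) (c%:R^-1 ^+ n) (2^-1 ^+ n) h => x y z h.
    by transitivity (x * y * (c%:R * U%:R * z)); [ring|rewrite h mul1r].
  rewrite [X in X < _]mulrA ltr_pdivrMr //.
  apply: (@le_lt_trans _ _ (c%:R * U%:R * 2^-1 ^+ n)).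
    by rewrite -h2 ler_wpM2l.
  have h3 : 2^-1 ^+ n < (1 - rho) / (80 * C * c%:R) by apply: hk2; lia.
  have cU0 : 0 < c%:R * U%:R :> R by rewrite mulr_gt0 // ltr0n.
  rewrite -(ltr_pM2l cU0) in h3; apply: lt_le_trans h3 _.
  rewrite le_eqVlt; apply/orP; left; apply/eqP; field.
  by rewrite !gt_eqF // ltr0n.
have tot : (\sum_(P <= p < P + U) (failures E b (N b) M (condA b) M p +
    failures E c (N c) M (condA c) M p + failures E b i M condB M p) < U)%N.
  rewrite -(ltr_nat R) !big_split /= !natrD.
  have := hA b; rewrite !inE eqxx => /(_ isT) hAb.
  have := hA c; rewrite !inE eqxx orbT => /(_ isT) hAc.
  apply: (@le_lt_trans _ _ (2 * C * U%:R * ((A b)%:R + (A c)%:R) * (rho ^+ w0 / (1 - rho)) +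
     20 * C * (M%:R * (rho ^+ (K' * n) / (1 - rho))))); first by lra.
  have X0 : 0 < 2 * C * U%:R * ((A b)%:R + (A c)%:R) by rewrite !mulr_gt0.
  rewrite -(ltr_pM2l X0) in hrho.
  have Y0 : 0 < 20 * C by rewrite mulr_gt0.
  rewrite -(ltr_pM2l Y0) in hrho2.
  apply: lt_trans (ltrD hrho hrho2) _.
  rewrite [X in X < _](_ : _ = U%:R / 2); first by lra.
  by field; rewrite !gt_eqF.
have [p [pP p0]] : exists p, (P <= p < P + U)%N /\
   (failures E b (N b) M (condA b) M p +
    failures E c (N c) M (condA c) M p + failures E b i M condB M p = 0)%N.
  apply: contrapT => hno; move: tot; rewrite ltnNge => /negP; apply.
  rewrite -{1}(addKn P U) -[X in (X <= _)%N]muln1 -sum_nat_const_nat big_nat [leqRHS]big_nat.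
  apply: leq_sum => p hp; rewrite lt0n; apply/eqP => h; apply: hno; exists p; split => //.
exists p; split => //; move: p0 => /eqP; rewrite !addn_eq0 -andbA => /and3P[/eqP fb /eqP fc /eqP fB].
have wM g w : (1 < g)%N -> (g ^ w <= M)%N -> (w < M)%N by move=> g1; apply: leq_trans (ltn_expl _ g1).
split=> [g gbc w h1 h2|w h1 h2].
  have [g1 fg] : (1 < g)%N /\ failures E g (N g) M (condA g) M p = 0%N.
    by move: gbc; rewrite !inE => /orP[/eqP->|/eqP->].
  apply: (failures_eq0 fg); first by rewrite /= h1.
  by apply: (wM g) => //; apply: leq_trans h2; rewrite leq_pexp2l ?leq_addl // ltnW.
by apply: (failures_eq0 fB); rewrite /= ?h1 // (wM b).
Qed.

(** * Real numbers and their digits *)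

Section shifted_digits.
Variable R : realType.
Implicit Types (r x : R).

Definition shifted (g : nat) r (n : nat) : nat := Num.truncn (g%:R ^+ n * r).

Lemma truncn_div x (q : nat) : 0 <= x -> (0 < q)%N ->
  Num.truncn (x / q%:R) = (Num.truncn x %/ q)%N.
Proof.
move=> x0 q0; have qR : 0 < q%:R :> R by rewrite ltr0n.
apply/eqP; rewrite truncn_eq ?divr_ge0 //.
have /andP[h1 h2] := truncn_itv x0; set t := Num.truncn x in h1 h2 *.
rewrite ler_pdivlMr // ltr_pdivrMr // -!natrM; apply/andP; split.
  by apply: le_trans h1; rewrite ler_nat leq_trunc_div.
by apply: lt_le_trans h2 _; rewrite ler_nat ltn_ceil.
Qed.

Lemma shiftedD g r n j : (0 < g)%N -> 0 <= r ->
  shifted g r n = (shifted g r (n + j) %/ g ^ j)%N.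
Proof.
move=> g0 r0; rewrite /shifted -truncn_div ?expn_gt0 ?g0 //; last first.
  by rewrite mulr_ge0 // exprn_ge0.
have gj : g%:R ^+ j != 0 :> R by rewrite expf_neq0 // pnatr_eq0 -lt0n.
by congr Num.truncn; rewrite exprD natrX mulrAC (mulfK gj).
Qed.

(** Blocks are indexed by their last digit, so counts over adjacent ranges add up without boundary
    terms. For [r < 1], blocks that would start before the first digit read zeros there. *)
Definition hits_in (g k sigma : nat) r (lo hi : nat) : nat :=
  \sum_(lo <= n < hi) (shifted g r n.+1 %% g ^ k == sigma)%N.

Lemma hits_in_le g k sigma r lo hi : (hits_in g k sigma r lo hi <= hi - lo)%N.
Proof.
rewrite /hits_in -[leqRHS]muln1 -sum_nat_const_nat; apply: leq_sum => i _.
exact: leq_b1.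
Qed.

Lemma hits_in_cat g k sigma r lo mid hi : (lo <= mid)%N -> (mid <= hi)%N ->
  hits_in g k sigma r lo hi = (hits_in g k sigma r lo mid + hits_in g k sigma r mid hi)%N.
Proof. by move=> h1 h2; rewrite /hits_in (big_cat_nat h1 h2). Qed.

(** Dropping the digits before place [i] affects only the blocks straddling it, fewer than [k] if
    [k > 0]. The index is reversed because [hits] counts from the last digit. *)
Lemma hits_in_window g k sigma r i w : (0 < g)%N -> 0 <= r ->
  (hits_in g k sigma r i (i + w) <= hits g k sigma w (shifted g r (i + w) %% g ^ w) + k)%N.
Proof.
move=> g0 r0; set t := shifted g r (i + w).
have -> : hits_in g k sigma r i (i + w) = (\sum_(j < w) ((t %/ g ^ j) %% g ^ k == sigma))%N.
  rewrite /hits_in -{1}[i]add0n big_addn addKn big_mkord (reindex_inj rev_ord_inj) /=.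
  apply: eq_bigr => j _; rewrite (@shiftedD g r _ j) // /t.
  rewrite (_ : (w - j.+1 + i).+1 + j = i + w)%N //; have := ltn_ord j; lia.
have -> : hits g k sigma w (t %% g ^ w) =
   (\sum_(j < w) (((t %% g ^ w) %/ g ^ j) %% g ^ k == sigma))%N by [].
apply: (@leq_trans (\sum_(j < w) (((t %% g ^ w) %/ g ^ j) %% g ^ k == sigma) +
    \sum_(j < w) ((w < j + k) && (j < w)))%N).
  rewrite -big_split /=; apply: leq_sum => j _; rewrite ltn_ord andbT.
  have [|jk] := ltnP w (j + k); first by rewrite addn1 => _; case: (_ == _).
  rewrite addn0 !modn_divl modn_dvdm // -expnD dvdn_exp2l //.
  by rewrite addnC.
rewrite leq_add2l -(big_mkord xpredT (fun j => nat_of_bool ((w < j + k) && (j < w))%N)).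
by apply: (@sum_nat_pred_le _ (w - k)) => p; lia.
Qed.

(** Scaled by [g^N] the gap is at most 1, so the integer part rises by at most one. *)
Lemma shifted_near g r N p M : 0 <= r -> (0 < M)%N ->
  p%:R / M%:R <= r -> (g ^ N)%:R * (r - p%:R / M%:R) <= 1 ->
  exists d : 'I_2, shifted g r N = ((g ^ N * p) %/ M + d)%N.
Proof.
move=> r0 M0 h1 h2; set t := ((g ^ N * p) %/ M)%N.
have MR : 0 < M%:R :> R by rewrite ltr0n.
have tl : t%:R <= g%:R ^+ N * r.
  apply: (@le_trans _ _ ((g ^ N * p)%N%:R / M%:R)).
    by rewrite ler_pdivlMr // -natrM ler_nat leq_trunc_div.
  by rewrite natrM natrX -mulrA ler_wpM2l // exprn_ge0.
have tu : g%:R ^+ N * r < (t + 2)%:R.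
  have X : (g ^ N * p)%N%:R / M%:R < t.+1%:R :> R.
    by rewrite ltr_pdivrMr // -natrM ltr_nat ltn_ceil.
  rewrite -addn1 natrD natrM natrX -mulrA in X.
  rewrite natrX mulrBr in h2; rewrite natrD; lra.
have s1 : (t <= shifted g r N)%N by rewrite truncn_ge_nat // (le_trans _ tl).
have s2 : (shifted g r N < t + 2)%N by rewrite truncn_lt_nat // (le_trans _ tl).
have d2 : (shifted g r N - t < 2)%N by lia.
by exists (Ordinal d2); rewrite /= subnKC.
Qed.

(** A window with [E * w < i] is not tested, but its at most [w] hits are absorbed by the term
    [g^k * i]. The term [E * k] pays for the blocks straddling place [i]. *)
Lemma hits_in_balanced E g k sigma r i w p M :
  (0 < g)%N -> 0 <= r -> (0 < M)%N -> (0 < k <= E)%N -> (sigma < g ^ k)%N ->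
  p%:R / M%:R <= r -> (g ^ (i + w))%:R * (r - p%:R / M%:R) <= 1 ->
  ((i <= E * w)%N -> balanced E g w ((g ^ (i + w) * p) %/ M)) ->
  (E * g ^ k * hits_in g k sigma r i (i + w) <= E * w + g ^ k * (w + E * k + i))%N.
Proof.
move=> g0 r0 M0 /andP[k0 kE] sg h1 h2 hb.
have [iw|iw] := leqP i (E * w); last first.
  have := hits_in_le g k sigma r i (i + w); rewrite addKn.
  set X := hits_in _ _ _ _ _ _; set B := (g ^ k)%N; clearbody X B => h.
  have : (E * B * X <= B * (E * w))%N by rewrite mulnCA mulnA leq_mul2l h orbT.
  have : (B * (E * w) <= B * i)%N by rewrite leq_mul2l ltnW ?orbT.
  lia.
have [d sE] := shifted_near r0 M0 h1 h2.
have := hits_in_window k sigma i w g0 r0; rewrite sE.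
move: (hb iw) => /forallP/(_ d); rewrite /unbalanced negb_exists => /forallP.
have kE' : (k < E.+1)%N by [].
move=> /(_ (Ordinal kE')); rewrite negb_exists => /forallP/(_ (Ordinal sg)) /=.
rewrite k0 /overfull -leqNgt; set H := hits _ _ _ _ _; set X := hits_in _ _ _ _ _ _.
set B := (g ^ k)%N; clearbody B H X => a1 a2.
have : (E * B * X <= E * B * (H + k))%N by rewrite leq_mul2l a2 orbT.
nia.
Qed.

End shifted_digits.

(** * Criteria for normality and for its failure *)

Section normality.
Variables (R : realType) (g : nat) (r : R).
Hypotheses (g1 : (1 < g)%N) (r0 : 0 <= r).

Let g0 : (0 < g)%N := ltnW g1.

Definition word_value (s : seq nat) : nat := foldl (fun v a => (v * g + a)%N) 0%N s.

Lemma word_value_rcons s a : word_value (rcons s a) = (word_value s * g + a)%N.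
Proof. by rewrite /word_value -cats1 foldl_cat. Qed.

Lemma word_value_lt s : all (fun a => (a < g)%N) s -> (word_value s < g ^ size s)%N.
Proof.
elim/last_ind: s => [|s a IH] //; rewrite all_rcons size_rcons word_value_rcons expnSr.
by move=> /andP[ag /IH h]; move: (g ^ _)%N h => G; nia.
Qed.

Lemma word_value_inj s t : size s = size t -> all (fun a => (a < g)%N) s ->
  all (fun a => (a < g)%N) t -> word_value s = word_value t -> s = t.
Proof.
elim/last_ind: s t => [|s a IH] t; first by move/esym/size0nil ->.
elim/last_ind: t => [|t a' _]; first by rewrite size_rcons.
rewrite !size_rcons !all_rcons !word_value_rcons => -[] st /andP[ag sg] /andP[ag' tg] E.
have aE : a = a' by have := congr1 (modn^~ g) E; rewrite /= !modnMDl !modn_small.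
rewrite aE in E *; move/addIn: E => /eqP; rewrite eqn_pmul2r // => /eqP E.
by rewrite (IH _ st).
Qed.

Lemma digit_lt n : (digit g r n < g)%N.
Proof. by rewrite ltn_mod. Qed.

Lemma shiftedS n : shifted g r n.+1 = (shifted g r n * g + digit g r n)%N.
Proof. by rewrite (shiftedD n 1 g0 r0) expn1 addn1; exact: divn_eq. Qed.

Lemma shifted_word i k :
  shifted g r (i + k) = (shifted g r i * g ^ k + word_value (map (digit g r) (iota i k)))%N.
Proof.
elim: k => [|k IH]; first by rewrite addn0 muln1 addn0.
rewrite addnS shiftedS IH -addn1 iotaD map_cat /= cats1 word_value_rcons expnD expn1; ring.
Qed.

Lemma word_at (s : seq nat) i : all (fun a => (a < g)%N) s ->
  (map (digit g r) (iota i (size s)) == s) =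
  (shifted g r (i + size s) %% g ^ size s == word_value s)%N.
Proof.
move=> sg; have dg : all (fun a => (a < g)%N) (map (digit g r) (iota i (size s))).
  by apply/allP => _ /mapP[j _ ->]; exact: digit_lt.
have sz : size (map (digit g r) (iota i (size s))) = size s by rewrite size_map size_iota.
rewrite shifted_word modnMDl modn_small; last by have := word_value_lt dg; rewrite sz.
by apply/eqP/eqP => [{1}->//|]; apply: word_value_inj.
Qed.

(** An occurrence starting at [i] ends at [i + size s - 1], whence the lower limit [(size s).-1]. *)
Lemma occurrences_hits_in (s : seq nat) n : all (fun a => (a < g)%N) s -> (0 < size s)%N ->
  occurrences s (mkseq (digit g r) n) =
  hits_in g (size s) (word_value s) r (size s).-1 n.
Proof.
move=> sg k0; rewrite /occurrences size_mkseq -sum1_count big_mkcond.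
rewrite -[iota 0 n.+1]/(index_iota 0 n.+1).
have [nk|kn] := ltnP n (size s).
  rewrite /hits_in [RHS]big_geq; last by rewrite -ltnS prednK.
  apply: big1_seq => i _; case: ifP => // /size_prefix.
  by rewrite size_drop size_mkseq => hh; have {}hh : (size s <= n - i)%N := hh; lia.
have h : (n.+1 - size s <= n.+1)%N by rewrite leq_subr.
rewrite (big_cat_nat (n := (n.+1 - size s)%N)) //= [X in (_ + X)%N]big1_seq; last first.
  move=> i /andP[_]; rewrite mem_index_iota => hi; case: ifP => // /size_prefix.
  by rewrite size_drop size_mkseq => hh; have {}hh : (size s <= n - i)%N := hh; lia.
rewrite addn0 /hits_in -[in RHS](add0n (size s).-1) big_addn.
rewrite (_ : n - (size s).-1 = n.+1 - size s)%N; last by lia.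
rewrite big_nat [RHS]big_nat; apply: eq_bigr => i /= hi.
rewrite -addnS prednK // -word_at // prefixE.
rewrite (_ : take _ (drop i _) = map (digit g r) (iota i (size s))); first by case: ifP.
have hh : (size s <= n - i)%N by move: hi kn; move: (size s : nat) => k *; lia.
by rewrite /mkseq -map_drop -map_take drop_iota take_iota add0n (minn_idPl hh).
Qed.

Lemma sum_hits_in k n : (\sum_(sigma < g ^ k) hits_in g k sigma r 0 n = n)%N.
Proof.
rewrite /hits_in exchange_big /= -[RHS]subn0 -[RHS]muln1 -sum_nat_const_nat.
apply: eq_bigr => i _.
have h : (shifted g r i.+1 %% g ^ k < g ^ k)%N by rewrite ltn_mod expn_gt0 g0.
rewrite (bigD1 (Ordinal h)) //= eqxx big1 // => j /eqP hj.
by apply/eqP; rewrite eqb0; apply/eqP => e; apply: hj; apply: val_inj.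
Qed.

(** The counts of the [g^k] blocks add up to [n], so upper bounds for all of them leave a lower
    bound for each. *)
Lemma normal_of_upper_density : r < 1 ->
  (forall k sigma, (0 < k)%N -> (sigma < g ^ k)%N -> forall q, (0 < q)%N ->
     exists n0, forall n, (n0 <= n)%N ->
       (q * g ^ k * hits_in g k sigma r 0 n <= q * n + g ^ k * n)%N) ->
  normal_numbers R g r.
Proof.
move=> r1 H; split; first by rewrite r0.
move=> s sg; set k := size s; set B := (g ^ k)%N.
apply/cvgrPdist_le => e e0.
(* The empty word occurs [n + 1] times among [n] digits, a ratio of [1 + 1/n]. *)
have [k0|k0] := posnP k.
  have -> : s = [::] by exact: size0nil.
  near=> n; rewrite /= /occurrences size_mkseq.
  rewrite (eq_count (a2 := predT)); last by move=> i; rewrite prefix0s.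
  rewrite count_predT size_iota k0 expr0 invr1.
  have n0 : 0 < n%:R :> R by rewrite ltr0n; near: n; exact: nbhs_infty_gt.
  have -> : 1 - n.+1%:R / n%:R = - n%:R^-1 :> R by rewrite -addn1 natrD; field; rewrite gt_eqF.
  have n0' : 0 <= n%:R^-1 :> R by rewrite invr_ge0.
  rewrite normrN ger0_norm // invf_ple ?posrE //; apply: ltW.
  by near: n; exact: nbhs_infty_gtr.
have B0 : 0 < B%:R :> R by rewrite ltr0n expn_gt0 g0.
(* Makes the accumulated error [B/q] less than [e/2]; the other half pays for the first [k]
   positions. *)
pose q := (Num.truncn (2 * B%:R / e)).+1.
have qe : 2 * B%:R / e < q%:R by exact: truncnS_gt.
have q0 : 0 < q%:R :> R by rewrite ltr0n.
have : forall sigma : 'I_B, exists n0, forall n, (n0 <= n)%N ->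
  (q * B * hits_in g k sigma r 0 n <= q * n + B * n)%N by move=> sigma; apply: H.
move=> /choice[n0 hn0].
near=> n.
have n1 : 0 < n%:R :> R by rewrite ltr0n; near: n; exact: nbhs_infty_gt.
have up (sigma : 'I_B) : (hits_in g k sigma r 0 n)%:R <= n%:R / B%:R + n%:R / q%:R :> R.
  have hn : (n0 sigma <= n)%N.
    apply: (@leq_trans (\max_(i < B) n0 i)); first exact: leq_bigmax.
    by near: n; exact: nbhs_infty_ge.
  have := hn0 sigma n hn; rewrite -(ler_nat R) natrD !natrM => h.
  have qB : 0 < q%:R * B%:R :> R by rewrite mulr_gt0.
  rewrite -(ler_pM2l qB); apply: le_trans h _; rewrite le_eqVlt; apply/orP; left; apply/eqP.
  by field; rewrite !gt_eqF.
have wB : (word_value s < B)%N by exact: word_value_lt.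
have lo : n%:R / B%:R - B%:R * (n%:R / q%:R) <= (hits_in g k (word_value s) r 0 n)%:R :> R.
  have := congr1 (fun m => m%:R : R) (sum_hits_in k n).
  rewrite (bigD1 (Ordinal wB)) //= natrD natr_sum.
  have : \sum_(i < B | i != Ordinal wB) (hits_in g k i r 0 n)%:R <=
     (B%:R - 1) * (n%:R / B%:R + n%:R / q%:R) :> R.
    apply: (@le_trans _ _ (\sum_(i < B | i != Ordinal wB) (n%:R / B%:R + n%:R / q%:R))).
      by apply: ler_sum => i _; exact: up.
    rewrite sumr_const cardC1 card_ord -[leLHS]mulr_natl ler_wpM2r //.
      by rewrite -subn1 natrB // expn_gt0 g0.
  have : B%:R * (n%:R / B%:R) = n%:R :> R by rewrite mulrC divfK // gt_eqF.
  have : 0 <= n%:R / q%:R :> R by rewrite divr_ge0.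
  move: (\sum_(_ < _ | _) _) => S; move: (n%:R / B%:R) (n%:R / q%:R) => x y *; nra.
have occ1 : (occurrences s (mkseq (digit g r) n) <= hits_in g k (word_value s) r 0 n)%N.
  rewrite occurrences_hits_in // -/k.
  have [kn|nk] := leqP k.-1 n; first by rewrite (@hits_in_cat _ g k _ r 0 k.-1 n) // leq_addl.
  by rewrite {1}/hits_in big_geq // ltnW.
have occ2 : (hits_in g k (word_value s) r 0 n <= occurrences s (mkseq (digit g r) n) + k)%N.
  rewrite occurrences_hits_in // -/k.
  have [kn|nk] := leqP k.-1 n.
    rewrite (@hits_in_cat _ g k _ r 0 k.-1 n) // addnC leq_add2l.
    by apply: leq_trans (hits_in_le _ _ _ _ _ _) _; rewrite subn0 leq_pred.
  by apply: leq_trans (hits_in_le _ _ _ _ _ _) _; lia.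
have kn : k%:R <= e / 2 * n%:R.
  have e2 : 0 < e / 2 by rewrite divr_gt0.
  rewrite mulrC -ler_pdivrMr //; apply: ltW; near: n; exact: nbhs_infty_gtr.
have Bq : B%:R * (n%:R / q%:R) <= e / 2 * n%:R :> R.
  rewrite mulrCA mulrC; apply: ler_wpM2r => //; rewrite ler_pdivrMr //.
  by move: qe; rewrite ltr_pdivrMr //; lra.
have upw := up (Ordinal wB); rewrite /= in upw.
rewrite -(ler_nat R) in occ1; rewrite -(ler_nat R) natrD in occ2.
have nn0 : n%:R != 0 :> R by rewrite gt_eqF.
rewrite -/k -natrX -/B -(ler_pM2r n1) -[X in _ * X]gtr0_norm // -normrM mulrBl (divfK nn0).
rewrite mulrC ler_norml.
have : n%:R / q%:R <= B%:R * (n%:R / q%:R) :> R.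
  by rewrite ler_peMl // ?divr_ge0 // ler1n expn_gt0 g0.
by move=> h; apply/andP; split; lra.
Unshelve. all: by end_near.
Qed.

Lemma zero_run_hits N l a : a%:R / (g ^ N)%:R <= r ->
  r < a%:R / (g ^ N)%:R + ((g ^ (N + l))%:R)^-1 -> hits_in g 1 0 r N (N + l) = l.
Proof.
move=> h1 h2; rewrite -[RHS](addKn N) -[RHS]muln1 -sum_nat_const_nat.
rewrite /hits_in big_nat [RHS]big_nat; apply: eq_bigr => n /andP[Nn nl].
have gN (m : nat) : 0 < (g ^ m)%:R :> R by rewrite ltr0n expn_gt0 g0.
have gE : (g ^ n.+1 = g ^ N * g ^ (n.+1 - N))%N by rewrite -expnD subnKC // leqW.
have : shifted g r n.+1 = (a * g ^ (n.+1 - N))%N.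
  apply/eqP; rewrite truncn_eq; last by rewrite mulr_ge0 // exprn_ge0.
  rewrite -natrX.
  have E : (g ^ n.+1)%:R * (a%:R / (g ^ N)%:R) = (a * g ^ (n.+1 - N))%N%:R :> R.
    rewrite gE !natrM; move: (gN N) (gN (n.+1 - N)%N) => x0 y0.
    by field; rewrite gt_eqF.
  apply/andP; split; first by rewrite -E ler_wpM2l.
  rewrite -[X in _ < X%:R]addn1 natrD -E.
  apply: (@lt_le_trans _ _ ((g ^ n.+1)%:R * (a%:R / (g ^ N)%:R + (g ^ (N + l))%:R^-1))).
    by rewrite ltr_pM2l.
  by rewrite mulrDr lerD2l ler_pdivrMr // mul1r ler_nat leq_pexp2l.
move=> ->; rewrite (_ : n.+1 - N = (n - N).+1)%N; last by lia.
by rewrite expn1 expnSr mulnA modnMl.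
Qed.

(** Zeros have limiting frequency [1/g <= 1/2] in a normal number, and a run of length proportional
    to [N] moves the frequency by a fixed amount, infinitely often. *)
Lemma not_normal_of_zero_runs (j : nat) :
  (forall n0, exists N a, [/\ (n0 <= N)%N, a%:R / (g ^ N)%:R <= r &
     r < a%:R / (g ^ N)%:R + ((g ^ (N + N %/ j.+1))%:R)^-1]) ->
  ~ normal_numbers R g r.
Proof.
move=> H [_ /(_ [:: 0%N])]; rewrite /= g0 => /(_ isT).
(* As [N < 2 * l * j.+1], this error times [N] is below [l/12]. The two estimates together lose at
   most [3 * e * N < l/4], while the run creates a discrepancy of at least [l/2]. *)
have e0 : 0 < (24 * j.+1%:R)^-1 :> R by rewrite invr_gt0 mulr_gt0.
move=> /cvgrPdist_le/(_ _ e0)[n0 _ hn0].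
(* The summand [j.+1] ensures that the run is nonempty. *)
have [N [a [hN h1 h2]]] := H (n0 + j.+1)%N.
set l := (N %/ j.+1)%N in h2.
have occE n : occurrences [:: 0%N] (mkseq (digit g r) n) = hits_in g 1 0 r 0 n.
  by rewrite occurrences_hits_in //= g0.
have l0 : (0 < l)%N by rewrite divn_gt0 //; lia.
have l1 : (N < l.*2 * j.+1)%N by have := ltn_ceil N (ltn0Sn j); rewrite -/l; nia.
have l2 : (l <= N)%N by exact: leq_div.
have N0 : (0 < N)%N by lia.
have := hn0 N; have := hn0 (N + l)%N; rewrite /= !occE expr1.
rewrite (@hits_in_cat _ g 1 0 r 0 N (N + l)) ?leq_addr // (zero_run_hits h1 h2).
move=> /(_ ltac:(lia)) + /(_ ltac:(lia)).
have nR : 0 < N%:R :> R by rewrite ltr0n.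
have nlR : 0 < (N + l)%:R :> R by rewrite ltr0n addn_gt0 N0.
have ratio (y h n e : R) : 0 < n -> `|y - h / n| <= e -> y * n - e * n <= h <= y * n + e * n.
  move=> n1; have nn0 := lt0r_neq0 n1; rewrite ler_norml => /andP[].
  rewrite -(ler_pM2r n1) -[y - _ <= _](ler_pM2r n1) !mulrBl (divfK nn0) mulNr.
  by move=> *; apply/andP; split; lra.
move=> /(ratio _ _ _ _ nlR)/andP[_ +] /(ratio _ _ _ _ nR)/andP[+ _].
have jR : 1 <= j.+1%:R :> R by rewrite ler1n.
have : (24 * j.+1%:R)^-1 * (24 * j.+1%:R) = 1 :> R by rewrite mulVf // gt_eqF // mulr_gt0.
rewrite -(ltr_nat R) -mul2n !natrM in l1; rewrite -(ler_nat R) in l2.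
have : g%:R^-1 <= 2^-1 :> R by rewrite lef_pV2 ?posrE ?ltr0n // ler_nat.
rewrite !natrD.
move: e0 ((hits_in _ _ _ _ _ _)%:R : R); set e := (24 * _)^-1 => e0 h; clearbody e.
set y := g%:R^-1; clearbody y.
set J := j.+1%:R in jR l1 *; clearbody J.
move: (N%:R : R) (l%:R : R) nR l1 l2 => n L *.
have : e * n < L / 12 by nra.
nra.
Qed.

End normality.

(** * The construction *)

(** The guard [0 < E] makes [E = 0] admissible at every [n] with [K = 2], a fallback before the
    thresholds of [exists_good] are reached. *)
Definition admissible (b c E K n : nat) : Prop :=
  [/\ (1 < K)%N, (E < K)%N, (E * n <= trunc_log b (c ^ (K * n)))%N &
    forall P, (P + c ^ (K * n - n).-1 <= c ^ (K * n))%N ->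
      exists p, (P <= p < P + c ^ (K * n - n).-1)%N /\ ((0 < E)%N -> good b c E n (K * n) p)].

(** Take for [e n] the largest [E <= n] with [Q E n]. *)
Lemma diagonal_precision (Q : nat -> nat -> Prop) : (forall n, Q 0%N n) ->
  (forall E, exists n0, forall n, (n0 <= n)%N -> Q E n) ->
  exists e : nat -> nat, (forall n, Q (e n) n) /\
    (forall E, exists n0, forall n, (n0 <= n)%N -> (E <= e n)%N).
Proof.
move=> Q0 HQ; exists (fun n => \max_(E < n.+1 | `[< Q E n >]) E)%N; split.
  move=> n; apply: (big_ind (fun m => Q m n)) => //.
    by move=> x y hx hy; rewrite /maxn; case: ifP.
  by move=> E /asboolP.
move=> E; have [n0 h0] := HQ E; exists (maxn n0 E) => n hn.
have En : (E < n.+1)%N by lia.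
apply: (@leq_bigmax_cond _ _ (fun i : 'I_n.+1 => i : nat) (Ordinal En)).
by apply/asboolP; apply: h0; lia.
Qed.

Lemma exists_schedule (R : archiRealFieldType) (b c : nat) :
  (1 < b)%N -> (1 < c)%N -> coprime b c ->
  exists E K : nat -> nat, (forall n, admissible b c (E n) (K n) n) /\
    (forall E0, exists n0, forall n, (n0 <= n)%N -> (E0 <= E n)%N).
Proof.
move=> b1 c1 cop.
have [E [hE Elim]] : exists E : nat -> nat, (forall n, exists K, admissible b c (E n) K n) /\
    (forall E0, exists n0, forall n, (n0 <= n)%N -> (E0 <= E n)%N).
  apply: (@diagonal_precision (fun E n => exists K, admissible b c E K n)).
    move=> n; exists 2%N; split => // P hP; exists P; split => //.
    by rewrite leqnn -{1}[P]addn0 ltn_add2l expn_gt0 ltnW.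
  case=> [|E].
    exists 0%N => n _; exists 2%N; split => // P hP; exists P; split => //.
    by rewrite leqnn -{1}[P]addn0 ltn_add2l expn_gt0 ltnW.
  have [K [n0 [EK hK hg]]] := exists_good R b1 c1 cop (ltn0Sn E).
  exists n0 => n hn; exists K; split => //; first by lia.
  by move=> P /(hg n hn P)[p [h1 h2]]; exists p.
by have [K hK] := choice hE; exists E, K.
Qed.

(** * Upper density from estimates on blocks *)

Definition diverges (u : nat -> nat) : Prop :=
  forall M, exists k0, forall k, (k0 <= k)%N -> (M <= u k)%N.

(** By [q * a j <= a j.+1], everything before the last complete block is negligible; that block and
    the current one obey the assumed estimate. *)
Lemma upper_density_of_blocks (R : realType) (g k sigma : nat) (r : R) (a : nat -> nat) :
  diverges a ->
  (forall q, exists k0, forall j, (k0 <= j)%N -> (q * a j <= a j.+1)%N /\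
     forall n, (a j <= n <= a j.+1)%N ->
       (q * g ^ k * hits_in g k sigma r (a j) n <= q * (n - a j) + g ^ k * n)%N) ->
  forall q, (0 < q)%N -> exists n0, forall n, (n0 <= n)%N ->
    (q * g ^ k * hits_in g k sigma r 0 n <= q * n + g ^ k * n)%N.
Proof.
(* The factor 3 splits the error among the initial part, the last complete block and the current
   block. *)
move=> adiv H q q0; have [k0 hk] := H (3 * q)%N; exists (a k0.+1) => n hn.
have ex : exists j, (k0 < j)%N && (n < a j.+1)%N.
  have [J hJ] := adiv n.+1; exists (maxn J k0.+1); rewrite leq_max leqnn orbT /=.
  by apply: hJ; lia.
case: (ex_minnP ex) => -[//|j] /andP[k0j nj] jmin.
have aj : (a j.+1 <= n)%N.
  move: k0j; rewrite leq_eqVlt => /orP[/eqP <- //|k0j]; rewrite leqNgt; apply/negP => h.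
  have := jmin j; rewrite -ltnS k0j h => /(_ isT); lia.
have [h1 h2] := hk j k0j; have [_ h3] := hk j.+1 (leqW k0j).
have jj : (a j <= a j.+1)%N by nia.
have h2' := h2 (a j.+1); rewrite jj leqnn in h2'; have {}h2 := h2' isT.
have h3' := h3 n; rewrite aj (ltnW nj) in h3'; have {}h3 := h3' isT.
rewrite (@hits_in_cat R g k sigma r 0 (a j) n) // ?(leq_trans jj) //.
rewrite (@hits_in_cat R g k sigma r (a j) (a j.+1) n) //.
have h0 := hits_in_le g k sigma r 0 (a j); rewrite subn0 in h0.
move: (hits_in _ _ _ _ 0 _) (hits_in _ _ _ _ (a j) _) (hits_in _ _ _ _ (a j.+1) _) h0 h2 h3 => X Y Z.
set B := (g ^ k)%N; clearbody B => h0 h2 h3; clear h2' h3' hk H adiv.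
rewrite -(@leq_pmul2l 3) //.
have e1 : (3 * q * B * X <= B * n)%N.
  apply: (@leq_trans (B * (3 * q * a j))); last by rewrite leq_mul2l (leq_trans h1) ?orbT.
  by rewrite [(3 * q * B)%N]mulnC -mulnA !leq_mul2l h0 !orbT.
have e2 : (B * a j.+1 <= B * n)%N by rewrite leq_mul2l aj orbT.
have e3 : (3 * q * (a j.+1 - a j) + 3 * q * (n - a j.+1) <= 3 * q * n)%N.
  by rewrite -mulnDr leq_mul2l; apply/orP; right; lia.
rewrite !mulnDr !mulnA; lia.
Qed.

(** After multiplication by [q/e], the term [2 * n] costs at most [B * n / 2], and so do the terms
    in [kk] and [X] together. *)
Lemma block_arith e B f d n kk q X : (0 < e)%N -> (4 * q <= e)%N ->
  (4 * q * kk + 2 * q * X <= n)%N ->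
  (e * B * f <= e * d + B * (2 * n + 2 * e * kk) + e * B * X)%N ->
  (q * B * f <= q * d + B * n)%N.
Proof.
move=> e0 qe qX H; rewrite -(@leq_pmul2l (2 * e)) ?muln_gt0 //.
have h1 : (2 * q * (e * B * f) <= 2 * q * (e * d + B * (2 * n + 2 * e * kk) + e * B * X))%N.
  by rewrite leq_mul2l H orbT.
have h2 : (B * (4 * q * n) <= B * (e * n))%N by rewrite leq_mul2l leq_mul2r qe !orbT.
have h3 : (B * (e * (4 * q * kk + 2 * q * X)) <= B * (e * n))%N by rewrite !leq_mul2l qX !orbT.
lia.
Qed.

(** * Nested intervals and their limit *)

Section construction.
Variables (R : realType) (b c : nat) (E K : nat -> nat) (pick : nat -> nat -> nat).
Hypotheses (b1 : (1 < b)%N) (c1 : (1 < c)%N).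
Hypothesis K1 : forall n, (1 < K n)%N.
Hypothesis pick_lt : forall n P, (P + c ^ (K n * n - n).-1 <= c ^ (K n * n))%N ->
  (P <= pick n P < P + c ^ (K n * n - n).-1)%N.

Let b0 : (0 < b)%N := ltnW b1.
Let c0 : (0 < c)%N := ltnW c1.

(* A state (x, n) stands for the interval [x, x + c^-n).  A stage first moves to
   [p/c^m, p/c^m + c^-(m+l)), forcing l zeros in base c, and then to
   [a/b^N, a/b^N + b^-(N+l')), forcing l' zeros in base b. *)
Implicit Type s : R * nat.

Definition scale s := (K s.2 * s.2)%N.
(** The successor rounds up strictly, so that the chosen point lies to the right of [s.1]. *)
Definition seed s := pick s.2 (Num.truncn (s.1 * (c ^ scale s)%:R)).+1.
Definition c_end s (j : nat) := (scale s + scale s %/ j.+1)%N.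
(** Two extra places make [b^-N] at most a quarter of [c^-c_end], leaving room for rounding up and
    for the next interval inside the base-[c] run. *)
Definition b_start s j := (up_log b (c ^ c_end s j)).+2.
Definition b_seed s j := ((b ^ b_start s j * seed s) %/ c ^ scale s).+1.
Definition b_end s (i j : nat) := (b_start s j + b_start s j %/ i.+1)%N.
Definition next (i j : nat) s : R * nat :=
  ((b_seed s j)%:R / (b ^ b_start s j)%:R, up_log c (b ^ b_end s i j)).

(** With [K > 1], the bound [2 <= s.2] gives [scale s >= s.2 + 2], the room required in
    [seed_bounds]. *)
Definition valid s : Prop := [/\ (2 <= s.2)%N, 0 <= s.1 & s.1 + ((c ^ s.2)%:R)^-1 <= 1].

Let cR n : 0 < (c ^ n)%:R :> R. Proof. by rewrite ltr0n expn_gt0 c0. Qed.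
Let bR n : 0 < (b ^ n)%:R :> R. Proof. by rewrite ltr0n expn_gt0 b0. Qed.

(** The interval has [c^(m-n) >= U + 2] grid steps of size [c^-m]: enough for rounding up, [U]
    candidates and the cell to the right of the chosen one. *)
Lemma seed_bounds s : valid s ->
  let P := (Num.truncn (s.1 * (c ^ scale s)%:R)).+1 in
  [/\ (P + c ^ (K s.2 * s.2 - s.2).-1 <= c ^ (K s.2 * s.2))%N,
    s.1 < (seed s)%:R / (c ^ scale s)%:R &
    (seed s)%:R / (c ^ scale s)%:R + ((c ^ scale s)%:R)^-1 < s.1 + ((c ^ s.2)%:R)^-1].
Proof.
case: s => x n [/= n2 x0 x1]; set m := scale (x, n).
set M : R := (c ^ m)%:R; have M0 : 0 < M by exact: cR.
have nm : (n + 2 <= m)%N by rewrite /m /scale /=; have := K1 n; nia.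
have xM : 0 <= x * M by rewrite mulr_ge0 // ltW.
have /andP[t1 t2] := truncn_itv xM.
rewrite /seed -/m -/M /=; set P := (Num.truncn _).+1 in t2 *.
set U := (c ^ (m - n).-1)%N.
have UE : (U.+1 < c ^ (m - n))%N.
  have -> : (m - n = (m - n).-1.+1)%N by lia.
  rewrite expnS -/U; have : (1 < U)%N; last by nia.
  by rewrite /U -(expn0 c) ltn_exp2l //; lia.
have DM : (c ^ n)%:R^-1 * M = (c ^ (m - n))%:R.
  have -> : M = (c ^ n)%:R * (c ^ (m - n))%:R.
    by rewrite /M -natrM -expnD subnKC //; lia.
  by rewrite mulKf // gt_eqF.
have PU : (P + U)%:R < (x + (c ^ n)%:R^-1) * M.
  rewrite mulrDl DM.
  have : P%:R <= x * M + 1 by rewrite /P -addn1 natrD lerD2r.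
  have : U%:R + 1 < (c ^ (m - n))%:R :> R by rewrite natr1 ltr_nat.
  by rewrite natrD; lra.
have PUM : (P + U <= c ^ m)%N.
  rewrite -(ler_nat R) -/M; apply: ltW; apply: lt_le_trans PU _.
  by rewrite -[leRHS]mul1r ler_pM2r.
have := pick_lt PUM; rewrite -/m -/U; set p := pick n P => /andP[Pp pU]; split => //.
  rewrite ltr_pdivlMr //; apply: lt_le_trans t2 _; by rewrite ler_nat.
rewrite -[X in _ + X]mul1r -mulrDl ltr_pdivrMr //; apply: le_lt_trans PU.
by rewrite natr1 ler_nat.
Qed.

(** The new left end lies at most [b^-N] above [p/c^m] and [b^-b_end <= b^-N], so together they use
    at most half of the base-[c] run. *)
Lemma next_bounds s i j : valid s ->
  [/\ (seed s)%:R / (c ^ scale s)%:R < (next i j s).1,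
   (next i j s).1 + ((b ^ b_end s i j)%:R)^-1 <
     (seed s)%:R / (c ^ scale s)%:R + ((c ^ c_end s j)%:R)^-1,
   ((c ^ (next i j s).2)%:R)^-1 <= ((b ^ b_end s i j)%:R)^-1 :> R,
   (next i j s).1 + ((c ^ (next i j s).2)%:R)^-1 < s.1 + ((c ^ s.2)%:R)^-1 &
   (s.2 < scale s < (next i j s).2)%N].
Proof.
move=> vs; have [_ h1 h2] := seed_bounds vs; case: vs => n2 x0 x1.
set p := seed s in h1 h2 *; set m := scale s in h1 h2 *.
set N := b_start s j; set T := (c ^ c_end s j)%N.
have mT : (c ^ m <= T)%N by rewrite leq_exp2l // leq_addr.
have NT : (4 * T <= b ^ N)%N.
  have -> : (b ^ N = b * (b * b ^ up_log b T))%N by rewrite -!expnS.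
  apply: (@leq_trans (2 * (2 * b ^ up_log b T))); last by rewrite !leq_mul.
  by rewrite mulnA leq_mul2l up_logP.
have TR : 0 < T%:R :> R by exact: cR.
have NR : 4 * (b ^ N)%:R^-1 <= T%:R^-1 :> R.
  by rewrite -ler_pdivlMl // -invfM lef_pV2 ?posrE ?mulr_gt0 // -natrM ler_nat.
have a1 : p%:R / (c ^ m)%:R < (b_seed s j)%:R / (b ^ N)%:R :> R.
  rewrite ltr_pdivlMr // mulrAC ltr_pdivrMr // -!natrM ltr_nat mulnC.
  by rewrite ltn_ceil // expn_gt0 c0.
have a2 : (b_seed s j)%:R / (b ^ N)%:R <= p%:R / (c ^ m)%:R + (b ^ N)%:R^-1 :> R.
  rewrite -[X in _ + X]mul1r /b_seed -[X in X%:R / _]addn1 natrD mulrDl lerD2r.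
  rewrite ler_pdivrMr // mulrAC ler_pdivlMr // -!natrM ler_nat [leqRHS]mulnC.
  exact: leq_trunc_div.
have Ne : (b ^ b_end s i j)%:R^-1 <= (b ^ N)%:R^-1 :> R.
  by rewrite lef_pV2 ?posrE // ler_nat leq_exp2l // leq_addr.
have N0 : 0 < (b ^ N)%:R^-1 :> R by rewrite invr_gt0.
have h3 : T%:R^-1 <= (c ^ m)%:R^-1 :> R by rewrite lef_pV2 ?posrE // ler_nat.
have h4 : (c ^ (next i j s).2)%:R^-1 <= (b ^ b_end s i j)%:R^-1 :> R.
  by rewrite lef_pV2 ?posrE // ler_nat up_logP.
split => //.
- by rewrite /next /= -/N; lra.
- by move: h4; rewrite /next /= -/N; lra.
- apply/andP; split; first by rewrite ltn_Pmull // (leq_trans _ n2).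
  rewrite -(@ltn_exp2l c) //; apply: leq_trans (up_logP _ c1).
  apply: (@leq_trans (b ^ N)); last by rewrite leq_exp2l // leq_addr.
  apply: leq_ltn_trans mT _; apply: leq_trans NT.
  by rewrite ltn_Pmull // expn_gt0 c0.
Qed.

Lemma next_valid s i j : valid s -> valid (next i j s).
Proof.
move=> vs; have [h1 _ _ h4 /andP[h5 h6]] := next_bounds i j vs; have [_ h7 _] := seed_bounds vs.
case: vs => n2 x0 x1; split; first by lia.
  by apply: le_trans x0 _; apply: ltW; apply: lt_trans h1.
by apply: ltW; apply: lt_le_trans h4 _.
Qed.

Variables al be : nat -> nat.

Fixpoint stage (k : nat) : R * nat :=
  if k is k'.+1 then next (al k') (be k') (stage k') else (0, 2%N).

Lemma stage_valid k : valid (stage k).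
Proof.
elim: k => [|k IH]; last exact: next_valid.
split => //=; rewrite add0r invf_le1 // ler1n expn_gt0 c0 //.
Qed.

Lemma stage_lt k : (stage k).1 < (stage k.+1).1 /\
  (stage k.+1).1 + ((c ^ (stage k.+1).2)%:R)^-1 < (stage k).1 + ((c ^ (stage k).2)%:R)^-1.
Proof.
have [h1 _ _ h4 _] := next_bounds (al k) (be k) (stage_valid k).
have [_ h7 _] := seed_bounds (stage_valid k); split => //.
exact: lt_trans h1.
Qed.

Lemma stage_mono k l : (k <= l)%N -> (stage k).1 <= (stage l).1 /\
  (stage l).1 + ((c ^ (stage l).2)%:R)^-1 <= (stage k).1 + ((c ^ (stage k).2)%:R)^-1.
Proof.
elim: l => [|l IH]; first by rewrite leqn0 => /eqP ->.
rewrite leq_eqVlt ltnS => /orP[/eqP->//|/IH[h1 h2]]; have [h3 h4] := stage_lt l.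
by split; apply: ltW; [apply: le_lt_trans h3|apply: lt_le_trans h2].
Qed.

Lemma stage_scale_ge k : (k <= (stage k).2)%N.
Proof.
elim: k => // k IH; have [_ _ _ _ /andP[h1 h2]] := next_bounds (al k) (be k) (stage_valid k).
by apply: leq_ltn_trans IH _; apply: ltn_trans h1 _.
Qed.

Definition limit_point : R := sup (range (fun k => (stage k).1)).

(** Strict on both sides because the interval of stage [k.+1] lies strictly inside that of stage
    [k]. *)
Lemma limit_point_bounds k :
  (stage k).1 < limit_point < (stage k).1 + ((c ^ (stage k).2)%:R)^-1.
Proof.
have ub l : ubound (range (fun k => (stage k).1)) ((stage l).1 + ((c ^ (stage l).2)%:R)^-1).
  move=> _ [k' _ <-]; case: (leqP l k') => [/stage_mono[_]|/ltnW/stage_mono[h _]].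
    by apply: le_trans; rewrite lerDl invr_ge0 ltW.
  by apply: le_trans h _; rewrite lerDl invr_ge0 ltW.
have le l : (stage l).1 <= limit_point.
  apply: ub_le_sup; last by exists l.
  by exists ((stage 0).1 + ((c ^ (stage 0).2)%:R)^-1); exact: ub.
have ge l : limit_point <= (stage l).1 + ((c ^ (stage l).2)%:R)^-1.
  by apply: ge_sup => //; exists (stage 0).1; exists 0%N.
have [h1 h2] := stage_lt k.
by apply/andP; split; [exact: lt_le_trans h1 (le _)|exact: le_lt_trans (ge _) h2].
Qed.

Lemma limit_point_c_run k :
  let s := stage k in
  (seed s)%:R / (c ^ scale s)%:R <= limit_point /\
  limit_point < (seed s)%:R / (c ^ scale s)%:R + ((c ^ c_end s (be k))%:R)^-1.
Proof.
move=> s; have [h1 h2 h3 _ _] := next_bounds (al k) (be k) (stage_valid k).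
have /andP[h4 h5] := limit_point_bounds k.+1; split; first exact: ltW (lt_trans h1 h4).
by apply: lt_trans h5 _; apply: le_lt_trans h2; rewrite lerD2l.
Qed.

Lemma limit_point_b_run k :
  let s := stage k in
  (b_seed s (be k))%:R / (b ^ b_start s (be k))%:R <= limit_point /\
  limit_point <
    (b_seed s (be k))%:R / (b ^ b_start s (be k))%:R + ((b ^ b_end s (al k) (be k))%:R)^-1.
Proof.
move=> s; have [_ _ h3 _ _] := next_bounds (al k) (be k) (stage_valid k).
have /andP[h4 h5] := limit_point_bounds k.+1; split; first exact: ltW.
by apply: lt_le_trans h5 _; rewrite lerD2l.
Qed.


(** * Digit statistics of the limit point *)

Hypothesis K_gt : forall n, (E n < K n)%N.
Hypothesis K_large : forall n, (E n * n <= trunc_log b (c ^ (K n * n)))%N.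
Hypothesis pick_good : forall n P, (P + c ^ (K n * n - n).-1 <= c ^ (K n * n))%N ->
  (0 < E n)%N -> good b c (E n) n (K n * n) (pick n P).
Hypothesis E_diverges : diverges E.

Let r := limit_point.
Let n_ k := (stage k).2.
Let m_ k := scale (stage k).
Let E_ k := E (n_ k).
Let pos_b k := up_log b (c ^ n_ k).

Let r0 : 0 <= r.
Proof. by have /andP[h _] := limit_point_bounds 0; exact: ltW h. Qed.

Let r1 : r < 1.
Proof.
have /andP[_ h] := limit_point_bounds 0; apply: lt_le_trans h _.
by have [_ _] := stage_valid 0.
Qed.

Let n_S k : (m_ k < n_ k.+1)%N.
Proof. by have [_ _ _ _ /andP[]] := next_bounds (al k) (be k) (stage_valid k). Qed.

Let n_le_m k : (n_ k <= m_ k)%N.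
Proof. by have [_ _ _ _ /andP[/ltnW]] := next_bounds (al k) (be k) (stage_valid k). Qed.

Let stage_good k : (0 < E_ k)%N -> good b c (E_ k) (n_ k) (m_ k) (seed (stage k)).
Proof. by move=> Ek; have [h _ _] := seed_bounds (stage_valid k); apply: pick_good. Qed.

Let seed_close k (G : nat) : (G <= c ^ c_end (stage k) (be k))%N ->
  (seed (stage k))%:R / (c ^ m_ k)%:R <= r /\
  G%:R * (r - (seed (stage k))%:R / (c ^ m_ k)%:R) <= 1.
Proof.
move=> hG; have [h1 h2] := limit_point_c_run k; split => //.
set T := (c ^ c_end (stage k) (be k))%N in hG h2.
apply: (@le_trans _ _ (T%:R * T%:R^-1)); last by rewrite divff // gt_eqF // cR.
by apply: ler_pM => //; rewrite ?subr_ge0 ?ler_nat // lerBlDl ltW.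
Qed.

(** Up to place [m_ k] the goodness of the seed controls the digits; every later place is counted as
    a hit. *)
Let block_c k kk sigma n : (0 < kk <= E_ k)%N -> (sigma < c ^ kk)%N -> (n_ k <= n)%N ->
  (E_ k * c ^ kk * hits_in c kk sigma r (n_ k) n <=
   E_ k * (n - n_ k) + c ^ kk * (2 * n + 2 * E_ k * kk) + E_ k * c ^ kk * (n - m_ k))%N.
Proof.
move=> hkk sg nk; have E0 : (0 < E_ k)%N by case/andP: hkk => h; apply: leq_trans.
have [gA _] := stage_good E0.
have main n' : (n_ k <= n')%N -> (n' <= m_ k)%N ->
   (E_ k * c ^ kk * hits_in c kk sigma r (n_ k) n' <=
    E_ k * (n' - n_ k) + c ^ kk * (n' - n_ k + E_ k * kk + n_ k))%N.
  move=> h1 h2; have nE : (n_ k + (n' - n_ k) = n')%N by rewrite subnKC.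
  have cn : (c ^ n' <= c ^ m_ k)%N by rewrite leq_exp2l.
  have cn2 : (c ^ n' <= c ^ c_end (stage k) (be k))%N.
    by apply: leq_trans cn _; rewrite leq_exp2l // leq_addr.
  have [h3 h4] := seed_close cn2.
  rewrite -{1}nE; apply: (hits_in_balanced (p := seed (stage k)) (M := (c ^ m_ k)%N)) => //.
  - by rewrite expn_gt0 c0.
  - by rewrite nE.
  - have := gA c; rewrite !inE eqxx orbT => /(_ isT (n' - n_ k)%N).
    by rewrite up_expnK // nE => h5 h6; apply: h5.
have [nm|/ltnW nm] := leqP n (m_ k).
  apply: leq_trans (main n nk nm) _; set B := (c ^ kk)%N; clearbody B.
  have -> : (n - n_ k + E_ k * kk + n_ k = n + E_ k * kk)%N by lia.
  apply: leq_trans (leq_addr _ _); rewrite leq_add2l leq_mul2l; apply/orP; right; lia.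
rewrite (hits_in_cat _ _ _ _ (n_le_m k) nm).
have a1 := main _ (n_le_m k) (leqnn _).
have a2 := hits_in_le c kk sigma r (m_ k) n.
move: (hits_in _ _ _ _ (n_ k) _) (hits_in _ _ _ _ (m_ k) _) a1 a2 => X Y a1 a2.
have a3 := n_le_m k; set B := (c ^ kk)%N in a1 *; clearbody B.
have b3 : (E_ k * B * Y <= E_ k * B * (n - m_ k))%N by rewrite leq_mul2l a2 orbT.
have b4 : (E_ k * (m_ k - n_ k) <= E_ k * (n - n_ k))%N by rewrite leq_mul2l leq_sub2r ?orbT.
have b5 : (B * (m_ k - n_ k + E_ k * kk + n_ k) <= B * (2 * n + 2 * E_ k * kk))%N.
  by rewrite leq_mul2l; apply/orP; right; lia.
rewrite mulnDr; lia.
Qed.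

Let i_ k := trunc_log b (c ^ m_ k).
(** The last controlled base-[b] place. The first bound is where agreement with the seed ends, up to
    a carry; the second is where the tested windows of length at most [i_ k], starting at [i_ k],
    end. *)
Let C_ k := minn (trunc_log b (c ^ c_end (stage k) (be k))) (2 * i_ k).

Let pos_b_le k : (pos_b k <= c * n_ k)%N.
Proof.
apply: up_log_min => //; rewrite expnM; apply: expn_mono.
by apply: leq_trans (expn_mono c b1); exact: ltnW (ltn_expl _ _).
Qed.

(** Three ranges: fresh windows up to [i_ k], far windows from there to [C_ k], and every place
    beyond [C_ k] counted as a hit. *)
Let block_b k kk sigma n : (c <= E_ k)%N -> (0 < kk <= E_ k)%N -> (sigma < b ^ kk)%N ->
  (pos_b k <= n)%N ->
  (E_ k * b ^ kk * hits_in b kk sigma r (pos_b k) n <=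
   E_ k * (n - pos_b k) + b ^ kk * (2 * n + 2 * E_ k * kk) + E_ k * b ^ kk * (n - C_ k))%N.
Proof.
move=> cE hkk sg nk; have E0 : (0 < E_ k)%N by case/andP: hkk => h; apply: leq_trans.
have [gA gB] := stage_good E0.
have cm0 : (0 < c ^ m_ k)%N by rewrite expn_gt0 c0.
have cT : (c ^ m_ k <= c ^ c_end (stage k) (be k))%N by rewrite leq_exp2l // leq_addr.
have bi : (b ^ i_ k <= c ^ m_ k)%N by exact: trunc_logP.
have pi : (pos_b k <= i_ k)%N.
  apply: leq_trans (pos_b_le k) _; apply: leq_trans (K_large _); rewrite leq_mul2r.
  by rewrite cE orbT.
have iC : (i_ k <= C_ k)%N by rewrite leq_min leq_trunc_log //=; lia.
have main n' : (pos_b k <= n')%N -> (n' <= i_ k)%N ->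
   (E_ k * b ^ kk * hits_in b kk sigma r (pos_b k) n' <=
    E_ k * (n' - pos_b k) + b ^ kk * (n' - pos_b k + E_ k * kk + pos_b k))%N.
  move=> h1 h2; have nE : (pos_b k + (n' - pos_b k) = n')%N by rewrite subnKC.
  have cn : (b ^ n' <= c ^ m_ k)%N by apply: leq_trans bi; rewrite leq_exp2l.
  have [h3 h4] := seed_close (leq_trans cn cT).
  rewrite -{1}nE; apply: (hits_in_balanced (p := seed (stage k)) (M := (c ^ m_ k)%N)) => //.
  - by rewrite nE.
  - have := gA b; rewrite !inE eqxx => /(_ isT (n' - pos_b k)%N).
    by rewrite -/(pos_b k) nE => h5 h6; apply: h5.
have main2 n' : (i_ k <= n')%N -> (n' <= C_ k)%N ->
   (E_ k * b ^ kk * hits_in b kk sigma r (i_ k) n' <=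
    E_ k * (n' - i_ k) + b ^ kk * (n' - i_ k + E_ k * kk + i_ k))%N.
  move=> h1; rewrite leq_min => /andP[h2 h2'].
  have nE : (i_ k + (n' - i_ k) = n')%N by rewrite subnKC.
  have cn : (b ^ n' <= c ^ c_end (stage k) (be k))%N.
    apply: (@leq_trans (b ^ trunc_log b (c ^ c_end (stage k) (be k)))).
      by rewrite leq_exp2l.
    by apply: trunc_logP; rewrite // expn_gt0 c0.
  have [h3 h4] := seed_close cn.
  rewrite -{1}nE; apply: (hits_in_balanced (p := seed (stage k)) (M := (c ^ m_ k)%N)) => //.
  - by rewrite nE.
  - move=> h5; apply: (gB _ h5); apply: leq_trans bi; rewrite leq_exp2l //.
    by move: h2'; rewrite leq_subLR mul2n addnn.
have [nm|/ltnW nm] := leqP n (i_ k).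
  apply: leq_trans (main n nk nm) _; set B := (b ^ kk)%N; clearbody B.
  apply: leq_trans (leq_addr _ _); rewrite leq_add2l leq_mul2l; apply/orP; right; lia.
rewrite (hits_in_cat _ _ _ _ pi nm).
have a1 := main _ pi (leqnn _).
set B := (b ^ kk)%N in a1 main2 *; clearbody B.
have [nC|/ltnW nC] := leqP n (C_ k).
  have a2 := main2 n nm nC.
  move: (hits_in _ _ _ _ (pos_b k) _) (hits_in _ _ _ _ (i_ k) _) a1 a2 => X Y a1 a2.
  apply: leq_trans (leq_addr _ _).
  have b4 : (E_ k * (n - pos_b k) = E_ k * (i_ k - pos_b k) + E_ k * (n - i_ k))%N.
    by rewrite -mulnDr; congr muln; lia.
  have b5 : (B * (i_ k - pos_b k + E_ k * kk + pos_b k) + B * (n - i_ k + E_ k * kk + i_ k) <=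
      B * (2 * n + 2 * E_ k * kk))%N.
    by rewrite -mulnDr leq_mul2l; apply/orP; right; lia.
  by rewrite mulnDr b4; lia.
rewrite (hits_in_cat _ _ _ _ iC nC).
have a2 := main2 _ iC (leqnn _).
have a3 := hits_in_le b kk sigma r (C_ k) n.
move: (hits_in _ _ _ _ (pos_b k) _) (hits_in _ _ _ _ (i_ k) _) (hits_in _ _ _ _ (C_ k) _) a1 a2 a3
   => X Y Z a1 a2 a3.
have b3 : (E_ k * B * Z <= E_ k * B * (n - C_ k))%N by rewrite leq_mul2l a3 orbT.
have b4 : (E_ k * (i_ k - pos_b k) + E_ k * (C_ k - i_ k) <= E_ k * (n - pos_b k))%N.
  by rewrite -mulnDr leq_mul2l; apply/orP; right; lia.
have b5 : (B * (i_ k - pos_b k + E_ k * kk + pos_b k) + B * (C_ k - i_ k + E_ k * kk + i_ k) <=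
      B * (2 * n + 2 * E_ k * kk))%N.
  by rewrite -mulnDr leq_mul2l; apply/orP; right; lia.
by rewrite !mulnDr; lia.
Qed.

Let n_diverges : diverges n_.
Proof. by move=> M; exists M => k hk; apply: leq_trans hk _; exact: stage_scale_ge. Qed.

Let E__diverges : diverges E_.
Proof.
move=> M; have [n0 h0] := E_diverges M; have [k0 h1] := n_diverges n0.
by exists k0 => k /h1 /h0.
Qed.

Let l_ k := (m_ k %/ (be k).+1)%N.
Let N_ k := b_start (stage k) (be k).
Let l'_ k := (N_ k %/ (al k).+1)%N.

Let m_ge k : (k <= m_ k)%N.
Proof. exact: leq_trans (stage_scale_ge k) (n_le_m k). Qed.

Let m_le_N k : (m_ k <= b * N_ k)%N.
Proof.
apply: leq_trans (_ : b * up_log b (c ^ c_end (stage k) (be k)) <= _)%N; last first.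
  by rewrite leq_mul2l /N_ /b_start; apply/orP; right; lia.
by apply: leq_trans (leq_mul_up_log _ b1 c1); rewrite leq_addr.
Qed.

Let N_le k : (N_ k <= c * (m_ k + l_ k) + 2)%N.
Proof.
rewrite /N_ /b_start addn2 !ltnS; apply: up_log_min => //; rewrite expnM; apply: expn_mono.
by apply: leq_trans (expn_mono c b1); exact: ltnW (ltn_expl _ _).
Qed.

(** [b^N] exceeds [c^c_end] by at most [b^3], so only the base-[b] run pays the crude conversion
    factor [b]. The coefficient 1 of [m_ k + l_ k] leaves a short uncontrolled stretch after
    [m_ k]. *)
Let n_S_le k : (n_ k.+1 <= 3 * b + m_ k + l_ k + b * l'_ k)%N.
Proof.
apply: up_log_min => //.
have bc x : (b ^ x <= c ^ (b * x))%N.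
  rewrite expnM; apply: expn_mono.
  by apply: leq_trans (expn_mono b c1); exact: ltnW (ltn_expl _ _).
have h : (b ^ N_ k <= b ^ 3 * c ^ c_end (stage k) (be k))%N.
  rewrite /N_ /b_start -addn2 expnD mulnC (expnD b 2 1) -mulnA leq_mul2l.
  by rewrite expn1 expn_up_log_le ?orbT // expn_gt0 c0.
apply: (@leq_trans (b ^ 3 * c ^ c_end (stage k) (be k) * b ^ l'_ k)).
  by rewrite /b_end expnD leq_mul2r h orbT.
apply: (@leq_trans (c ^ (b * 3) * c ^ c_end (stage k) (be k) * c ^ (b * l'_ k))).
  by rewrite !leq_mul ?bc.
by rewrite -!expnD leq_exp2l // /c_end -/(m_ k) -/(l_ k); lia.
Qed.

(** Between [m_ k] and the next block there are only the two runs and a bounded rest. Divergence of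
    [be] and [al] makes the runs negligible relative to [n]. *)
Lemma limit_point_normal_c : diverges al -> diverges be -> normal_numbers R c r.
Proof.
move=> hal hbe; apply: normal_of_upper_density => // kk sigma kk0 sg.
apply: (upper_density_of_blocks n_diverges) => q.
have [k1 h1] := E__diverges (4 * q + kk + 1)%N.
(* The factors [b] and [c] pay for measuring the base-[b] run in base-[c] places; [L] below absorbs
   the bounded terms. *)
have [k2 h2] := hal (16 * q * b * c)%N; have [k3 h3] := hbe (16 * q)%N.
pose L := (16 * (6 * q * b + 4 * q * kk + 1))%N.
exists (k1 + k2 + k3 + L)%N => k hk.
have Ek : (4 * q + kk + 1 <= E_ k)%N by apply: h1; lia.
have ak : (16 * q * b * c <= al k)%N by apply: h2; lia.
have bk : (16 * q <= be k)%N by apply: h3; lia.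
split.
  apply: (@leq_trans (K (n_ k) * n_ k)); last exact: ltnW (n_S k).
  rewrite leq_mul2r; apply/orP; right; apply: ltnW; apply: leq_ltn_trans (K_gt _).
  by apply: leq_trans Ek; lia.
move=> n /andP[nk nS].
apply: (block_arith (e := E_ k) (kk := kk) (X := (n - m_ k)%N)); [lia|lia| |]; last first.
  by apply: block_c => //; rewrite kk0; lia.
have kn : (L <= n)%N.
  by apply: leq_trans nk; apply: leq_trans (stage_scale_ge k); lia.
have [nm|mn] := leqP n (m_ k).
  rewrite (_ : n - m_ k = 0)%N ?muln0 ?addn0; last by lia.
  by apply: leq_trans kn; rewrite /L; lia.
have e1 : (l_ k * (be k).+1 <= m_ k)%N by exact: leq_trunc_div.
have e2 : (l'_ k * (al k).+1 <= N_ k)%N by exact: leq_trunc_div.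
have e3 := N_le k; have e4 := n_S_le k.
have e5 : (l_ k <= m_ k)%N by exact: leq_div.
have f1 : (16 * q * l_ k <= n)%N.
  apply: (@leq_trans (l_ k * (be k).+1)); last by lia.
  by rewrite mulnC leq_mul2l (leqW bk) orbT.
have f2 : (16 * q * b * l'_ k <= 2 * n + 2)%N.
  rewrite -(@leq_pmul2l c) //.
  apply: (@leq_trans (l'_ k * (al k).+1)).
    have -> : (c * (16 * q * b * l'_ k) = l'_ k * (16 * q * b * c))%N by ring.
    by rewrite leq_mul2l (leqW ak) orbT.
  apply: leq_trans e2 _; apply: leq_trans e3 _; rewrite mulnDr.
  have : (c * (m_ k + l_ k) <= c * (2 * n))%N by rewrite leq_mul2l; apply/orP; right; lia.
  by have := c1; lia.
have f3 : (q * (n - m_ k) <= q * (3 * b + l_ k + b * l'_ k))%N.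
  by rewrite leq_mul2l; apply/orP; right; lia.
move: kn; rewrite /L => kn.
have f4 : (q * (3 * b + l_ k + b * l'_ k) = 3 * (q * b) + q * l_ k + q * b * l'_ k)%N by ring.
rewrite -!mulnA in f1 f2 kn *; rewrite -!mulnA in f4; lia.
Qed.

(** However long the base-[c] run, [c_end] is at most [2 * m], so the tested base-[b] windows reach
    its end up to a bounded error. Only the base-[b] run stays uncontrolled, and [al] makes it
    negligible. *)
Lemma limit_point_normal_b : diverges al -> normal_numbers R b r.
Proof.
move=> hal; apply: normal_of_upper_density => // kk sigma kk0 sg.
have iS k : (i_ k <= pos_b k.+1)%N.
  rewrite -(@leq_exp2l b) //; apply: leq_trans (trunc_logP b1 _) _; first by rewrite expn_gt0 c0.
  by apply: leq_trans (up_logP _ b1); rewrite leq_exp2l // ltnW.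
have posdiv : diverges pos_b.
  move=> M; exists (b * M)%N => k hk.
  have := leq_mul_up_log (n_ k) b1 c1; rewrite -/(pos_b k) => h.
  rewrite -(@leq_pmul2l b) //; apply: leq_trans h; apply: leq_trans hk _.
  exact: stage_scale_ge.
apply: (upper_density_of_blocks posdiv) => q.
have [k1 h1] := E__diverges (4 * q + kk + c + q * c)%N.
have [k2 h2] := hal (16 * q)%N.
pose L := (16 * (2 * q * (c + 5) + 4 * q * kk + 1))%N.
have [k3 h3] := posdiv L.
exists (k1 + k2 + k3)%N => k hk.
have Ek : (4 * q + kk + c + q * c <= E_ k)%N by apply: h1; lia.
have ak : (16 * q <= al k)%N by apply: h2; lia.
have Lk : (L <= pos_b k)%N by apply: h3; lia.
split.
  apply: leq_trans (iS k); apply: leq_trans (K_large _).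
  apply: (@leq_trans (q * (c * n_ k))); first by rewrite leq_mul2l pos_b_le orbT.
  by rewrite mulnA leq_mul2r; apply/orP; right; apply: leq_trans Ek; lia.
move=> n /andP[nk nS].
apply: (block_arith (e := E_ k) (kk := kk) (X := (n - C_ k)%N)); [lia|lia| |]; last first.
  by apply: block_b => //; [lia|rewrite kk0; lia].
have kn : (L <= n)%N by exact: leq_trans Lk nk.
have [nm|mn] := leqP n (C_ k).
  rewrite (_ : n - C_ k = 0)%N ?muln0 ?addn0; last by lia.
  by apply: leq_trans kn; rewrite /L; lia.
have e2 : (l'_ k * (al k).+1 <= N_ k)%N by exact: leq_trunc_div.
set D := trunc_log b (c ^ c_end (stage k) (be k)).
have ND : (N_ k <= D + 3)%N.
  rewrite /N_ /b_start addn3 !ltnS; apply: up_log_min => //.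
  by apply: ltnW; exact: trunc_log_ltn.
have Di : (D <= 2 * i_ k + 1)%N.
  rewrite -ltnS -(@ltn_exp2l b) //.
  apply: leq_ltn_trans (trunc_logP b1 _) _; first by rewrite expn_gt0 c0.
  apply: (@leq_ltn_trans (c ^ (m_ k + m_ k))).
    by rewrite leq_exp2l // leq_add2l leq_div.
  have := @trunc_log_ltn b (c ^ m_ k) b1; rewrite -/(i_ k) => h.
  rewrite expnD (_ : (2 * i_ k + 1).+1 = (i_ k).+1 + (i_ k).+1)%N; last by lia.
  by rewrite expnD ltn_mul.
have DC : (D <= C_ k + 1)%N by rewrite /C_ -/D; lia.
have pS : (pos_b k.+1 <= c + N_ k + l'_ k)%N.
  apply: up_log_min => //; apply: (@leq_trans (c * b ^ b_end (stage k) (al k) (be k))).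
    by apply: expn_up_log_le; rewrite // expn_gt0 b0.
  rewrite -addnA expnD leq_mul //.
  by apply: leq_trans (expn_mono c b1); exact: ltnW (ltn_expl _ _).
have f0 : (16 * q * l'_ k <= n + 4)%N.
  apply: (@leq_trans (l'_ k * (al k).+1)); last by lia.
  by rewrite mulnC leq_mul2l (leqW ak) orbT.
have f3 : (q * (n - C_ k) <= q * (c + 5 + l'_ k))%N.
  by rewrite leq_mul2l; apply/orP; right; lia.
move: kn; rewrite /L => kn; rewrite mulnDr in f3.
rewrite -!mulnA in f0 kn *; lia.
Qed.

(** If [al k < M] at arbitrarily late stages, zero runs of relative length about [1/(M+1)] recur. *)
Lemma limit_point_not_normal_b : ~ diverges al -> ~ normal_numbers R b r.
Proof.
move=> /existsNP[M /forallNP hM]; apply: (not_normal_of_zero_runs b1 r0 (j := M)) => n0.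
(* Since [k <= m_ k <= b * N_ k], stages from [b * n0] on have runs starting at or beyond [n0]. *)
have /existsNP[k /not_implyP[hk aM]] := hM (b * n0)%N.
exists (N_ k), (b_seed (stage k) (be k)); have [h1 h2] := limit_point_b_run k; split => //.
  rewrite -(@leq_pmul2l b) //; apply: leq_trans hk _; apply: leq_trans (m_ge k) _; exact: m_le_N.
apply: lt_le_trans h2 _; rewrite lerD2l lef_pV2 ?posrE ?bR // ler_nat leq_exp2l //.
rewrite /b_end leq_add2l; apply: leq_div2l => //.
by move/negP: aM; rewrite -ltnNge ltnS => /leqW.
Qed.

Lemma limit_point_not_normal_c : ~ diverges be -> ~ normal_numbers R c r.
Proof.
move=> /existsNP[M /forallNP hM]; apply: (not_normal_of_zero_runs c1 r0 (j := M)) => n0.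
have /existsNP[k /not_implyP[hk aM]] := hM n0.
exists (m_ k), (seed (stage k)); have [h1 h2] := limit_point_c_run k; split => //.
  by apply: leq_trans hk (m_ge k).
apply: lt_le_trans h2 _; rewrite lerD2l lef_pV2 ?posrE ?cR // ler_nat leq_exp2l //.
rewrite /c_end leq_add2l; apply: leq_div2l => //.
by move/negP: aM; rewrite -ltnNge ltnS => /leqW.
Qed.

End construction.

(** * Coding Pi03 sets by divergence *)

Definition locally_constant (X : topologicalType) (T : Type) (f : X -> T) : Prop :=
  forall x, \forall y \near x, f y = f x.

Lemma near_finite (X : topologicalType) (x : X) (t : nat) (P : nat -> X -> Prop) :
  (forall i, \forall y \near x, P i y) -> \forall y \near x, forall i, (i < t)%N -> P i y.
Proof.
move=> h; elim: t => [|t IH]; first by apply: nearW => y i; rewrite ltn0.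
near=> y; move=> i; rewrite ltnS leq_eqVlt => /orP[/eqP ->|]; first by near: y; exact: h.
by move: i; near: y.
Unshelve. all: by end_near.
Qed.

Section codes.
Variables (R : realType) (X : topologicalType).
Hypotheses (polX : polish_space R X) (cloX : clopen_based X).

(** Balls of radius [1/(n+1)] around a countable dense set form a countable base. For each ball that
    fits into some clopen subset of [U], one such subset is chosen. *)
Lemma open_bigcup_clopen (U : set X) : open U ->
  exists W : nat -> set X, (forall i, clopen (W i)) /\ U = \bigcup_i W i.
Proof.
move=> oU; have [[D cD dD] [d [[d0 _ dC dT] dtop _]]] := polX.
have [g ginj] : exists g : X -> nat, {in D &, injective g} by apply/countable_injP.
pose rad n : R := n.+1%:R^-1.
pose nice y n V := [/\ clopen V, V `<=` U & [set z | d y z < rad n] `<=` V].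
(* Indices that code no such ball receive the empty set. *)
have : forall i : nat, exists V : set X, [/\ clopen V, V `<=` U &
    forall y n, D y -> pickle (g y, n) = i -> (exists V', nice y n V') ->
      [set z | d y z < rad n] `<=` V].
  move=> i; have [[y [n [Dy yi [V [h1 h2 h3]]]]]|hno] := pselect (exists y n,
      [/\ D y, pickle (g y, n) = i & exists V, nice y n V]).
    exists V; split => // y' n' Dy'; rewrite -yi => /(pcan_inj pickleK)[gy ->] _.
    by rewrite (ginj y' y) // inE.
  exists set0; split => //; first exact: clopen0.
  by move=> y n Dy yi hV; exfalso; apply: hno; exists y, n.
move=> /choice[W hW]; exists W; split; first by move=> i; have [] := hW i.
apply/seteqP; split => [x Ux|x [i _ Wx]]; last by have [_ sub _] := hW i; exact: sub.
have [V [cV Vx] VU] : filter_from [set V | clopen V /\ V x] id U.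
  by apply: cloX.2; apply: open_nbhs_nbhs.
have : nbhs x V by apply: open_nbhs_nbhs; split => //; exact: cV.1.
rewrite dtop => -[e /= e0 eV].
pose n := Num.truncn (2 / e).
have rn : rad n < e / 2.
  rewrite /rad -[e / 2]invrK ltf_pV2 ?posrE ?invr_gt0 ?divr_gt0 //.
  by rewrite invfM invrK mulrC; exact: truncnS_gt.
have rn0 : 0 < rad n by rewrite invr_gt0.
have nO : nbhs x [set z | d x z < rad n] by rewrite dtop; exists (rad n).
have [||y [/interior_subset/= xy Dy]] := dD (interior [set z | d x z < rad n]).
- by exists x; exact: nO.
- exact: open_interior.
have [_ _ /(_ y n Dy erefl) h] := hW (pickle (g y, n)).
exists (pickle (g y, n)) => //; apply: h; last by rewrite /= dC.
exists V; split => // z /= yz; apply: eV => /=.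
by apply: le_lt_trans (dT x y z) _; lra.
Qed.

Lemma clopen_locally_constant (W : set X) : clopen W ->
  forall x, \forall y \near x, W y <-> W x.
Proof.
move=> [oW cW] x; have [Wx|Wx] := pselect (W x).
  have : \forall y \near x, W y by apply: open_nbhs_nbhs.
  by apply: filterS => y Wy; split.
have : \forall y \near x, (~` W) y by apply: open_nbhs_nbhs; split => //; exact: closed_openC.
by apply: filterS => y Wy; split.
Qed.

(* The index of the first closed piece not yet refuted at time t; it stabilises exactly on
   the union of the pieces. *)
Lemma Fsigma_code (F : set X) : Fsigma F ->
  exists ch : nat -> X -> bool, (forall t, locally_constant (ch t)) /\
    forall x, F x <-> exists T, forall t, (T <= t)%N -> ch t x = false.
Proof.
move=> [C cC FE].
have : forall j, exists W : nat -> set X, (forall i, clopen (W i)) /\ ~` C j = \bigcup_i W i.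
  by move=> j; apply: open_bigcup_clopen; exact: closed_openC.
move=> /choice[W hW].
(* Membership in [C j] is not yet refuted by the first [t] clopen pieces of its complement. *)
pose v j t x := `[< forall i, (i < t)%N -> ~ W j i x >].
have vC j x : C j x <-> forall t, v j t x.
  have [_ WE] := hW j; split => [Cx t|h].
    apply/asboolP => i _ Wx; have : (~` C j) x by rewrite WE; exists i.
    exact.
  apply: contrapT => nC; have : (~` C j) x by []. rewrite WE => -[i _ Wx].
  by have /asboolP/(_ i (ltnSn i)) := h i.+1.
have vS j t x : v j t.+1 x -> v j t x.
  by move=> /asboolP h; apply/asboolP => i it; apply: h; apply: leqW.
have vmono j t t' x : (t <= t')%N -> v j t' x -> v j t x.
  by move=> /subnKC <-; elim: (t' - t)%N => [|n IH]; rewrite ?addn0 // addnS => /vS.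
(* If all of the first [t] closed sets are refuted, [find] returns the default [t]. *)
pose J t x := find (fun j => v j t x) (iota 0 t).
have Jle t x : (J t x <= t)%N by rewrite -[leqRHS](size_iota 0) find_size.
have Jv t x : (J t x < t)%N -> v (J t x) t x.
  move=> h; have := @nth_find _ 0%N (fun j => v j t x) (iota 0 t).
  by rewrite has_find size_iota => /(_ h); rewrite nth_iota.
have Jmin t x j : (j < J t x)%N -> ~~ v j t x.
  move=> h; have := @before_find _ 0%N (fun j => v j t x) (iota 0 t) j h.
  by rewrite nth_iota ?(leq_trans h) // => ->.
have JS t x : (J t x <= J t.+1 x)%N.
  rewrite leqNgt; apply/negP => h; have := Jv t.+1 x.
  rewrite (leq_trans h) ?leqW // => /(_ isT)/vS; exact/negP/Jmin.
have Jmono t t' x : (t <= t')%N -> (J t x <= J t' x)%N.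
  by move=> /subnKC <-; elim: (t' - t)%N => [|n IH]; rewrite ?addn0 // addnS (leq_trans IH).
exists (fun t x => J t x != J t.+1 x); split.
  have loc t : locally_constant (J t).
    move=> x; near=> y; apply: eq_in_find => j; rewrite mem_iota add0n /= => jt.
    apply/asbool_equiv_eq; have hy : forall j, (j < t)%N -> forall i, (i < t)%N -> W j i y <-> W j i x.
      near: y; apply: (@near_finite X x t (fun j y => forall i, (i < t)%N -> W j i y <-> W j i x)) => j'.
      apply: (@near_finite X x t (fun i y => W j' i y <-> W j' i x)) => i.
      by apply: clopen_locally_constant; have [] := hW j'.
    by split => h i it Wi; apply: (h i it); apply/hy.
  move=> t x; near=> y; congr (~~ (_ == _)); near: y; exact: loc.
move=> x; split.
  rewrite FE => -[j _ /vC Cj].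
  have Jj t : (J t x <= j)%N by rewrite leqNgt; apply/negP => /Jmin; rewrite Cj.
  apply: contrapT => /forallNP hno.
  have : forall n, exists t, (n <= J t x)%N.
    elim=> [|n [t IH]]; first by exists 0%N.
    have /existsNP[t' /not_implyP[tt' /eqP]] := hno t; rewrite eqbF_neg negbK => ch.
    exists t'.+1; apply: leq_ltn_trans (leq_trans IH (Jmono _ _ x tt')) _.
    by rewrite ltn_neqAle ch JS.
  by move=> /(_ j.+1)[t]; rewrite leqNgt ltnS Jj.
move=> [T hT].
have Jc t : (T <= t)%N -> J t x = J T x.
  move=> /subnKC <-; elim: (t - T)%N => [|n IH]; first by rewrite addn0.
  by rewrite addnS -IH; have /negbFE/eqP := hT (T + n)%N (leq_addr _ _).
rewrite FE; exists (J T x) => //; apply/vC => t.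
(* Exceeding [J T x] ensures that the search at time [t'] succeeded and did not return its
   default. *)
pose t' := maxn (maxn t T) (J T x).+1.
have tt' : (t <= t')%N by rewrite /t'; lia.
have Tt' : (T <= t')%N by rewrite /t'; lia.
apply: (vmono _ _ t') => //; rewrite -(Jc t' Tt'); apply: Jv; rewrite Jc //.
by rewrite /t'; lia.
Unshelve. all: by end_near.
Qed.

(** The index coding [(i, t)] carries [i] if the code of [F i] changes at time [t], and [i + t]
    otherwise. Infinitely many changes for one [i] repeat the value [i] forever; finitely many for
    each [i] leave every value attained finitely often. *)
Lemma Pi03_code (A : set X) : Pi03 A ->
  exists al : X -> nat -> nat, (forall k, locally_constant (al ^~ k)) /\
    forall x, A x <-> diverges (al x).
Proof.
move=> [F FF AE].
have : forall i, exists ch : nat -> X -> bool, (forall t, locally_constant (ch t)) /\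
    forall x, F i x <-> exists T, forall t, (T <= t)%N -> ch t x = false.
  by move=> i; apply: Fsigma_code.
move=> /choice[ch hch].
exists (fun x k => if pickle_inv k is Some (i, t) then
   (if ch i t x then i else i + t)%N else k); split.
  move=> k x /=; case: (pickle_inv k) => [[i t]|]; last exact: nearW.
  by near=> y; congr (if _ then _ else _); near: y; exact: (hch i).1.
move=> x; split => [Ax M|div].
  have : forall i, exists T, forall t, (T <= t)%N -> ch i t x = false.
    by move=> i; apply/(hch i).2; move: Ax; rewrite AE; apply.
  move=> /choice[T hT]; pose S := (M + \sum_(i < M) T i)%N.
  (* Lies beyond the codes of all pairs with [i < M] and [t < S], the only pairs whose value can be
     below [M]. *)
  exists (M + \sum_(i < M) \sum_(t < S) (pickle (i : nat, t : nat)).+1)%N => k hk.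
  case E : (pickle_inv k) => [[i t]|]; last by lia.
  have kE : pickle (i, t) = k by have := @pickle_invK (nat * nat)%type k; rewrite /oapp E.
  case: (leqP M i) => [Mi|iM]; first by case: ifP => // _; apply: leq_trans Mi (leq_addr _ _).
  have [tS|St] := ltnP t S.
    move: hk; rewrite (bigD1 (Ordinal iM)) //= (bigD1 (Ordinal tS)) //= kE; lia.
  rewrite hT; first by move: St; rewrite /S; lia.
  by apply: leq_trans St; rewrite /S (bigD1 (Ordinal iM)) //=; lia.
rewrite AE => i _; apply/(hch i).2; have [k0 hk0] := div i.+1.
(* Exceeds every time coordinate coded below [k0], so any later change of the code of [F i] would
   have index at least [k0] and value [i]. *)
exists (\sum_(k < k0) (if (pickle_inv k : option (nat * nat)) is Some (_, t) then t.+1 else 0))%N.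
move=> t ht; apply/negbTE/negP => c.
have pE : pickle_inv (pickle (i, t)) = Some (i, t) by exact: pickleK_inv.
have h : (pickle (i, t) < k0)%N.
  by rewrite ltnNge; apply/negP => h; have := hk0 _ h; rewrite pE c ltnn.
move: ht; by rewrite (bigD1 (Ordinal h)) //= pE; lia.
Unshelve. all: by end_near.
Qed.

End codes.

(** * Continuity of the limit point in the codes *)

Section continuity.
Variables (R : realType) (b c : nat) (K : nat -> nat) (pick : nat -> nat -> nat).

Lemma stage_ext al al' be be' k : (forall i, (i < k)%N -> al i = al' i) ->
  (forall i, (i < k)%N -> be i = be' i) ->
  stage R b c K pick al be k = stage R b c K pick al' be' k.
Proof.
elim: k => //= k IH ha hb; rewrite ha // hb // IH // => i ik; [apply: ha|apply: hb]; exact: leqW.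
Qed.

Hypotheses (b1 : (1 < b)%N) (c1 : (1 < c)%N).
Hypothesis K1 : forall n, (1 < K n)%N.
Hypothesis pick_lt : forall n P, (P + c ^ (K n * n - n).-1 <= c ^ (K n * n))%N ->
  (P <= pick n P < P + c ^ (K n * n - n).-1)%N.

(** The first [k] code values fix stage [k], hence the limit up to [c^-k], and they are constant
    near [x]. *)
Lemma continuous_limit_point (X : topologicalType) (al be : X -> nat -> nat) :
  (forall k, locally_constant (al ^~ k)) -> (forall k, locally_constant (be ^~ k)) ->
  continuous (fun x => limit_point R b c K pick (al x) (be x)).
Proof.
move=> ha hb x; apply/cvgrPdist_lt => e e0.
have c0 : 0 < c%:R^-1 :> R by rewrite invr_gt0 ltr0n ltnW.
have c2 : c%:R^-1 < 1 :> R by rewrite invf_lt1 ?ltr0n ?ltr1n // ltnW.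
have [k0 hk0] := exp_lt_eventually c0 c2 e0.
near=> y.
have ea : forall i, (i < k0)%N -> al y i = al x i.
  by near: y; apply: (@near_finite X x k0 (fun i y => al y i = al x i)) => i; exact: ha.
have eb : forall i, (i < k0)%N -> be y i = be x i.
  by near: y; apply: (@near_finite X x k0 (fun i y => be y i = be x i)) => i; exact: hb.
have := limit_point_bounds R b1 c1 K1 pick_lt (al x) (be x) k0.
have := limit_point_bounds R b1 c1 K1 pick_lt (al y) (be y) k0.
rewrite (stage_ext ea eb).
have := hk0 _ (stage_scale_ge R b1 c1 K1 pick_lt (al x) (be x) k0).
rewrite exprVn -natrX ltr_norml; set s := stage _ _ _ _ _ _ _ _.
by move=> h /andP[h1 h2] /andP[h3 h4]; apply/andP; split; lra.
Unshelve. all: by end_near.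
Qed.

End continuity.

(** * Normality as a countable intersection of Fsigma conditions *)

Lemma Pi03_bigcap_countable (T : topologicalType) (J : countType) (F : J -> set T) :
  (forall i, Fsigma (F i)) -> Pi03 (\bigcap_i F i).
Proof.
move=> hF; exists (fun n => if unpickle n is Some i then F i else setT).
  by move=> n; case: unpickle => // ; apply: closed_Fsigma; exact: closedT.
apply/seteqP; split => x h i _; last by have := h (pickle i) I; rewrite pickleK.
by case: unpickle => // j; apply: h.
Qed.

Section normal_numbers_Pi03.
Variables (R : realType) (g : nat).
Hypothesis g1 : (1 < g)%N.

Let g0 : (0 < g)%N := ltnW g1.

(** The expansion ends in zeros, so runs of relative length 1 start at every late place. *)
Lemma adic_not_normal (a n : nat) : ~ normal_numbers R g (a%:R / (g ^ n)%:R).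
Proof.
have gR m : 0 < (g ^ m)%:R :> R by rewrite ltr0n expn_gt0 g0.
apply: (@not_normal_of_zero_runs R g _ g1 _ 0); first by rewrite divr_ge0.
move=> n0; exists (maxn n0 n), (a * g ^ (maxn n0 n - n))%N.
have -> : (a * g ^ (maxn n0 n - n))%N%:R / (g ^ maxn n0 n)%:R = a%:R / (g ^ n)%:R :> R.
  have -> : (g ^ maxn n0 n = g ^ (maxn n0 n - n) * g ^ n)%N.
    by rewrite -expnD subnK // leq_maxr.
  have z0 := lt0r_neq0 (gR (maxn n0 n - n)%N); have w0 := lt0r_neq0 (gR n).
  by rewrite !natrM; field; rewrite z0 w0.
by split; [exact: leq_maxl|exact: lexx|rewrite ltrDl invr_gt0].
Qed.

(** Not being an endpoint, [x] lies in the interior of its digit cylinder. *)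
Lemma digit_locally_constant (x : R) (n : nat) : 0 < x ->
  (forall a m : nat, x <> a%:R / (g ^ m)%:R) -> \forall y \near x, digit g y n = digit g x n.
Proof.
move=> x0 hx; set G : R := g%:R ^+ n.+1.
have G0 : 0 < G by rewrite exprn_gt0 // ltr0n.
have Gx0 : 0 <= G * x by rewrite mulr_ge0 // ltW.
set t := Num.truncn (G * x).
have /andP[t1 t2] := truncn_itv Gx0; rewrite -/t in t1 t2.
have t1' : t%:R / G < x.
  rewrite lt_neqAle ler_pdivrMr // [x * G]mulrC t1 andbT; apply/eqP => h.
  by apply: (hx t n.+1); rewrite natrX -/G -h.
have t2' : x < t.+1%:R / G by rewrite ltr_pdivlMr // [x * G]mulrC.
near=> y; rewrite /digit -/G -/t; congr (_ %% _)%N.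
have y1 : t%:R / G < y by near: y; exact: lt_nbhsr.
have y2 : y < t.+1%:R / G by near: y; exact: lt_nbhsl.
have y0 : 0 <= y by apply: ltW; apply: le_lt_trans y1; apply: divr_ge0 => //; exact: ltW.
apply/eqP; rewrite truncn_eq; last by apply: mulr_ge0 => //; exact: ltW.
by rewrite [G * y]mulrC -ler_pdivrMr // (ltW y1) -ltr_pdivlMr.
Unshelve. all: by end_near.
Qed.

Let deviation (s : seq nat) (n : nat) (x : R) : R :=
  `|g%:R ^- size s - (occurrences s (mkseq (digit g x) n))%:R / n%:R|.

Let level (s : seq nat) (k n : nat) : set R := closure [set x | deviation s n x <= k.+1%:R^-1].

(** The three kinds of condition share one countable index type: the range, avoidance of [g]-adic
    rationals, and the tolerance [1/(k+1)] for the frequency of [s]. The closed range [[0, 1]] loses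
    its endpoints to the second kind. *)
Let constraint (i : unit + (nat * nat) + (seq nat * nat)) : set R :=
  match i with
  | inl (inl _) => [set x | 0 <= x <= 1]
  | inl (inr (a, m)) => [set~ a%:R / (g ^ m)%:R]
  | inr (s, k) => if all (fun a => (a < g)%N) s then
      \bigcup_N \bigcap_(n in [set n | (N <= n)%N]) level s k n else setT
  end.

Let Fsigma_setC1 (a : R) : Fsigma [set~ a].
Proof.
exists (fun n => [set x | x <= a - n.+1%:R^-1] `|` [set x | a + n.+1%:R^-1 <= x]).
  by move=> n; apply: closedU; [exact: closed_le|exact: closed_ge].
apply/seteqP; split => x /=.
  move=> /eqP; rewrite neq_lt => /orP[h|h].
    have h0 : 0 < a - x by rewrite subr_gt0.
    exists (Num.truncn (a - x)^-1) => //; left => /=.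
    rewrite lerBrDr -lerBrDl invf_ple ?posrE //; apply: ltW; exact: truncnS_gt.
  have h0 : 0 < x - a by rewrite subr_gt0.
  exists (Num.truncn (x - a)^-1) => //; right => /=.
  rewrite -lerBrDl invf_ple ?posrE //; apply: ltW; exact: truncnS_gt.
move=> [n _ [|]] /= h xa; move: h; rewrite xa.
  by rewrite lerBrDr gerDl leNgt invr_gt0 ltr0n.
by rewrite gerDl leNgt invr_gt0 ltr0n.
Qed.

Let Fsigma_constraint i : Fsigma (constraint i).
Proof.
case: i => [[_|[a m]]|[s k]] /=; last 1 first.
- case: ifP => _; last by apply: closed_Fsigma; exact: closedT.
  exists (fun N => \bigcap_(n in [set n | (N <= n)%N]) level s k n) => // N.
  by apply: closed_bigI => n _; exact: closed_closure.
- apply: closed_Fsigma.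
  rewrite (_ : [set x | _] = [set x : R | 0 <= x] `&` [set x : R | x <= 1]).
    by apply: closedI; [exact: closed_ge|exact: closed_le].
  by apply/seteqP; split => x /= => [/andP[]|[-> ->]].
- exact: Fsigma_setC1.
Qed.

(* Away from the g-adic rationals digits are locally constant, so there the closures in
   [level] add no points. *)
Lemma Pi03_normal_numbers : Pi03 (normal_numbers R g).
Proof.
suff -> : normal_numbers R g = \bigcap_i constraint i.
  exact: Pi03_bigcap_countable Fsigma_constraint.
apply/seteqP; split => x.
  move=> nx; have [/andP[x0 x1] hx] := nx.
  case=> [[_|[a m]]|[s k]] _ /=; first by rewrite x0 ltW.
    by move=> xE; apply: (@adic_not_normal a m); rewrite -xE.
  case: ifP => // /hx /cvgrPdist_le h.
  have k0 : 0 < k.+1%:R^-1 :> R by [].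
  have [N _ hN] := h _ k0; exists N => // n /= Nn.
  by apply: subset_closure; exact: hN.
move=> h; have /andP[x0 x1] : 0 <= x <= 1 by exact: (h (inl (inl tt)) I).
have hx a m : x <> a%:R / (g ^ m)%:R by exact: (h (inl (inr (a, m))) I).
have x0' : 0 < x.
  by rewrite lt_neqAle x0 andbT eq_sym; apply/eqP => xE; apply: (hx 0%N 0%N); rewrite mul0r.
have x1' : x < 1.
  by rewrite lt_neqAle x1 andbT; apply/eqP => xE; apply: (hx 1%N 0%N); rewrite divr1.
split; first by rewrite x0 x1'.
move=> s sg; apply/cvgrPdist_le => e e0.
have := h (inr (s, Num.truncn e^-1)) I; rewrite /= sg => -[N _ hN].
exists N => // n /= Nn; have := hN n Nn => cl.
(* A point of the set under the closure can be found so close to [x] that its first [n] digits,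
   hence its deviation, are those of [x]. *)
have nb : \forall y \near x, forall i, (i < n)%N -> digit g y i = digit g x i.
  apply: (@near_finite R x n (fun i y => digit g y i = digit g x i)) => i.
  exact: digit_locally_constant.
have [y [/= hy ydig]] := cl _ nb.
have E : mkseq (digit g x) n = mkseq (digit g y) n.
  by apply/eq_in_map => i; rewrite mem_iota add0n => /= hi; rewrite ydig.
rewrite E; apply: le_trans hy _.
rewrite invf_ple ?posrE //; apply: ltW; exact: truncnS_gt.
Qed.

End normal_numbers_Pi03.

(** * The class of the difference set and the continuous reduction *)

Theorem theorem1p3 (R : realType) (b c : nat)
    (hb : (2 <= b)%N) (hc : (2 <= c)%N) (hbc : coprime b c) :
  complete_for (D2 Pi03) (normal_numbers R b `\` normal_numbers R c).
Proof.
split.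
  by exists (normal_numbers R b), (normal_numbers R c); split => //; exact: Pi03_normal_numbers.
move=> X polX cloX B [A1 [A2 [hA1 hA2 ->]]].
have [al [alc alE]] := Pi03_code polX cloX hA1.
have [be [bec beE]] := Pi03_code polX cloX hA2.
have [E [K [adm Ediv]]] := exists_schedule R hb hc hbc.
have rows n : exists pick : nat -> nat, forall P,
    (P + c ^ (K n * n - n).-1 <= c ^ (K n * n))%N ->
    (P <= pick P < P + c ^ (K n * n - n).-1)%N /\
    ((0 < E n)%N -> good b c (E n) n (K n * n) (pick P)).
  have [_ _ _ hP] := adm n.
  have h P : exists p, (P + c ^ (K n * n - n).-1 <= c ^ (K n * n))%N ->
     (P <= p < P + c ^ (K n * n - n).-1)%N /\ ((0 < E n)%N -> good b c (E n) n (K n * n) p).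
    (* The value 0 is a dummy for those [P] whose candidates would overrun [c^m]. *)
    have [h|h] := boolP (P + c ^ (K n * n - n).-1 <= c ^ (K n * n))%N; last by exists 0%N.
    by have [p hp] := hP P h; exists p.
  by have [f hf] := choice h; exists f.
have [pick pickP] := choice rows.
have K1 n : (1 < K n)%N by have [] := adm n.
have KE n : (E n < K n)%N by have [] := adm n.
have KL n : (E n * n <= trunc_log b (c ^ (K n * n)))%N by have [] := adm n.
have pl n P h' := (pickP n P h').1.
have pg n P h' := (pickP n P h').2.
exists (fun x => limit_point R b c K pick (al x) (be x)).
  exact: continuous_limit_point.
(* Where [al x] does not diverge, the limit is not [b]-normal and both sides fail. Elsewhere
   [c]-normality is equivalent to divergence of [be x]. *)
apply/seteqP; split => x /=.
  move=> [/alE da ndb]; split; first exact: (limit_point_normal_b R hb hc K1 pl (be x) KL pg Ediv).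
  apply: (limit_point_not_normal_c hb hc K1 pl) => /beE; exact: ndb.
move=> [nb nc]; have da : diverges (al x).
  by apply: contrapT => nd; exact: (limit_point_not_normal_b hb hc K1 pl) nd nb.
split; first exact/alE.
move=> /beE db; apply: nc; exact: (limit_point_normal_c R hb hc K1 pl KE pg Ediv).
Qed.
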